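(* Let $\alpha,\beta>0$, $n\ge 2$, $N=\binom{n}{2}$, and let $\{G(t),\ t\ge 0\}$ be the dynamic Erdős–Rényi graph on $n$ vertices (generated by Poisson edge updates, as described in the context) starting in a given state, i.e. $\mathbb{P}(G(0)=\sigma)=1$ for some $\sigma$ in the state space $\{0,1\}^N$. For each vertex pair $\{u,v\}$ let $T_{u,v}$ be the fastest time to stationarity for the edge process $\{\chi_{u,v}(t),\ t\ge 0\}$, namely the first point of the Poisson process of update times of the pair $\{u,v\}$. Then $$T_s=\max_{u,v}\{T_{u,v}\}$$ is the fastest time to stationarity for $\{G(t),\ t\ge 0\}$. Furthermore, for all $t\ge 0$, $$\mathbb{P}(T_s\le t)=\left(1-e^{-\left(\alpha+\frac{\beta}{n-1}\right)t}\right)^{N}.$$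
   Context: Dynamic Erdős–Rényi graph: fix $\alpha,\beta>0$ and an integer $n\ge 2$, and let $N=\binom n2$. There are $n$ fixed vertices. For each pair $\{u,v\}$ of distinct vertices, $\chi_{u,v}(t)\in\{0,1\}$ indicates whether an edge is present between $u$ and $v$ at time $t$ (the edge process), and $G(t)=(\chi_{1,2}(t),\dots,\chi_{n-1,n}(t))\in\{0,1\}^N$. Independently for each vertex pair, the state of the edge is updated at the points of a Poisson process with intensity $\alpha+\frac{\beta}{n-1}$; at each update, independently of the Poisson process and of previous states, the edge is present after the update with probability $p=\frac{\beta}{\beta+(n-1)\alpha}$ and absent with probability $1-p$. (Equivalently, absent edges appear at rate $\frac{\beta}{n-1}$ and present edges disappear at rate $\alpha$, independently over vertex pairs.) The unique stationary distribution of $\{G(t)\}$ is that of the static Erdős–Rényi graph $G(n,p)$ (edges present independently with probability $p$), and that of $\chi_{u,v}$ is Bernoulli($p$). Let $\{\mathcal F_t,\ t\ge0\}$ be the filtration where $\mathcal F_t$ is the information generated by the update times and corresponding edge updates up to time $t$ (with the initial state). Randomized stopping time: let $\mathcal F_\infty$ be the smallest $\sigma$-algebra containing all $\mathcal F_t$, and let $\mathcal G$ be a sub-$\sigma$-algebra of the underlying $\sigma$-algebra that is independent of $\mathcal F_\infty$. A random variable $T$ with values in $[0,\infty]$ is a randomized stopping time relative to $\{\mathcal F_t\}$ if $\{T\le t\}\in\sigma(\mathcal F_t,\mathcal G)$ for every $t\ge0$ (for some such $\mathcal G$). Strong stationary time: for a process $X$ adapted to $\{\mathcal F_t\}$ with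 state space $S$ and unique stationary distribution $\pi$, a randomized stopping time $T$ relative to $\{\mathcal F_t\}$ is a strong stationary time for $X$ if $\mathbb P(T\le t,\ X(T)=y\mid T<\infty)=\mathbb P(T\le t\mid T<\infty)\,\pi(y)$ for all $0\le t<\infty$ and $y\in S$. Fastest time to stationarity: a strong stationary time $T$ for $X$ such that $\mathbb P(T>t)\le\mathbb P(T'>t)$ for all $t$ and for every other strong stationary time $T'$ for $X$. *)

(* Defs.v *)
From HB Require Import structures.
From mathcomp Require Import all_boot all_order all_algebra finmap.
From mathcomp Require Import all_classical all_reals all_analysis.
From mathcomp Require Import measurable_realfun.

Set Implicit Arguments.
Unset Strict Implicit.
Unset Printing Implicit Defensive.

Import Order.TTheory GRing.Theory Num.Theory.
Import numFieldNormedType.Exports.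

Local Open Scope classical_set_scope.
Local Open Scope ring_scope.

Definition mutually_independent {R : realType} {d} {Omega : measurableType d}
    (P : probability Omega R) (I : choiceType)
    (E : I -> set_system Omega) : Prop :=
  forall (J : {fset I}) (A : I -> set Omega),
    (forall i, i \in J -> E i (A i)) ->
    fine (P (\bigcap_(i in [set` J]) A i)) = \prod_(i <- J) fine (P (A i)).

(* Equal to 0 when [P B = 0], since [x / 0 = 0]. *)
Definition cond_prob {R : realType} {d} {Omega : measurableType d}
    (P : probability Omega R) (A B : set Omega) : R :=
  fine (P (A `&` B)) / fine (P B).

(* [N t] is the number of points in [0, t]; only times [t >= 0] matter.
   Paths are counting paths everywhere, not just almost surely.  The increment
   law is required for [s < t] only because [poisson_pmf] is not meaningful at
   rate 0; the [nat] subtraction is exact since paths are nondecreasing. *)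
Record poisson_process {R : realType} {d} {Omega : measurableType d}
    (P : probability Omega R) (rate : R) (N : R -> {RV P >-> nat}) : Prop := {
  poisson_start : forall w, N 0 w = 0%N ;
  poisson_nondecreasing :
    forall w s t, 0 <= s -> s <= t -> (N s w <= N t w)%N ;
  poisson_right_continuous :
    forall w t, 0 <= t -> \forall s \near t^'+, N s w = N t w ;
  poisson_independent_increments :
    forall t : R^nat, 0 <= t 0%N -> nondecreasing_seq t ->
      mutually_independent P (fun i : nat =>
        g_sigma_algebra_preimage (fun w => (N (t i.+1) w - N (t i) w)%N)) ;
  poisson_increment_law :
    forall s t k, 0 <= s -> s < t ->
      P [set w | (N t w - N s w)%N = k] = (poisson_pmf (rate * (t - s)) k)%:E }.

Definition sigma_process {R : realType} {d} {Omega : measurableType d}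
    {P : probability Omega R} (N : R -> {RV P >-> nat}) : set_system Omega :=
  <<s \bigcup_(t in [set t : R | 0 <= t]) g_sigma_algebra_preimage (N t) >>.

(* The infimum is attained by right continuity, and is [+oo] if there is no
   point at all. *)
Definition first_point {R : realType} {d} {Omega : measurableType d}
    {P : probability Omega R} (N : R -> {RV P >-> nat}) (w : Omega) : \bar R :=
  ereal_inf [set t%:E | t in [set t : R | 0 <= t /\ (0 < N t w)%N]].

Definition vpair (n : nat) : finType := {e : {set 'I_n} | #|e| == 2%N}.

Definition update_rate {R : realType} (alpha beta : R) (n : nat) : R :=
  alpha + beta / (n%:R - 1).

Definition edge_prob {R : realType} (alpha beta : R) (n : nat) : R :=
  beta / (beta + (n%:R - 1) * alpha).

(* [N e t] counts the updates of the pair [e] up to time [t], and [U e k] is the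
   outcome of the update number [k + 1] of [e].  The last field makes the update
   processes of all pairs and all the outcomes jointly independent. *)
Record dynamic_er_updates {R : realType} (alpha beta : R) {n : nat} {d}
    {Omega : measurableType d} (P : probability Omega R)
    (N : vpair n -> R -> {RV P >-> nat})
    (U : vpair n -> nat -> {RV P >-> bool}) : Prop := {
  update_times_poisson :
    forall e, poisson_process (update_rate alpha beta n) (N e) ;
  update_outcome_law :
    forall e k, P [set w | U e k w] = (edge_prob alpha beta n)%:E ;
  updates_independent :
    mutually_independent P (fun i : vpair n + vpair n * nat =>
      match i with
      | inl e => sigma_process (N e)
      | inr (e, k) => g_sigma_algebra_preimage (U e k)
      end) }.

(* [X0 e] is the initial state of the pair [e]. *)
Definition er_edge {R : realType} {n : nat} {d} {Omega : measurableType d}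
    {P : probability Omega R} (N : vpair n -> R -> {RV P >-> nat})
    (U : vpair n -> nat -> {RV P >-> bool}) (X0 : vpair n -> {RV P >-> bool})
    (e : vpair n) (t : R) (w : Omega) : bool :=
  if N e t w is k.+1 then U e k w else X0 e w.

Definition er_graph {R : realType} {n : nat} {d} {Omega : measurableType d}
    {P : probability Omega R} (N : vpair n -> R -> {RV P >-> nat})
    (U : vpair n -> nat -> {RV P >-> bool}) (X0 : vpair n -> {RV P >-> bool})
    (t : R) (w : Omega) : {ffun vpair n -> bool} :=
  [ffun e => er_edge N U X0 e t w].

(* Generated by the initial state, the update times up to time [t], and the
   outcomes of those updates. *)
Definition er_filtration {R : realType} {n : nat} {d} {Omega : measurableType d}
    {P : probability Omega R} (N : vpair n -> R -> {RV P >-> nat})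
    (U : vpair n -> nat -> {RV P >-> bool}) (X0 : vpair n -> {RV P >-> bool})
    (t : R) : set_system Omega :=
  <<s [set A | [\/ exists e b, A = [set w | X0 e w = b],
      exists e s k, [/\ 0 <= s, s <= t & A = [set w | N e s w = k]]
    | exists e s k b, [/\ 0 <= s, s <= t &
        A = [set w | (k < N e s w)%N /\ U e k w = b]]]] >>.

(* The law of the static graph G(n, p), as a probability mass function. *)
Definition static_er_pmf {R : realType} (p : R) (n : nat)
    (y : {ffun vpair n -> bool}) : R :=
  \prod_(e : vpair n) bernoulli_pmf p (y e).

Definition sigma_infty {R : realType} {Omega : Type}
    (F : R -> set_system Omega) : set_system Omega :=
  <<s \bigcup_(t in [set t : R | 0 <= t]) F t >>.

Definition adapted {R : realType} {Omega : Type} {S : countType}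
    (F : R -> set_system Omega) (X : R -> Omega -> S) : Prop :=
  forall t y, 0 <= t -> F t [set w | X t w = y].

Definition randomized_stopping_time {R : realType} {d}
    {Omega : measurableType d} (P : probability Omega R)
    (F : R -> set_system Omega) (T : Omega -> \bar R) : Prop :=
  [/\ measurable_fun setT T, (forall w, (0 <= T w)%E) &
    exists G : set_system Omega,
      [/\ sigma_algebra setT G, G `<=` measurable,
          (forall A B, sigma_infty F A -> G B ->
            P (A `&` B) = (P A * P B)%E) &
          forall t, 0 <= t -> <<s F t `|` G >> [set w | (T w <= t%:E)%E]]].

(* [pi] is the probability mass function of the stationary distribution of [X].
   If [T] is infinite almost surely, the last condition holds trivially. *)
Definition strong_stationary_time {R : realType} {d}
    {Omega : measurableType d} (P : probability Omega R) {S : countType}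
    (F : R -> set_system Omega) (X : R -> Omega -> S) (pi : S -> R)
    (T : Omega -> \bar R) : Prop :=
  [/\ adapted F X, randomized_stopping_time P F T &
    forall t y, 0 <= t ->
      cond_prob P [set w | (T w <= t%:E)%E /\ X (fine (T w)) w = y]
                  [set w | (T w < +oo)%E] =
      cond_prob P [set w | (T w <= t%:E)%E] [set w | (T w < +oo)%E] * pi y].

Definition fastest_time_to_stationarity {R : realType} {d}
    {Omega : measurableType d} (P : probability Omega R) {S : countType}
    (F : R -> set_system Omega) (X : R -> Omega -> S) (pi : S -> R)
    (T : Omega -> \bar R) : Prop :=
  strong_stationary_time P F X pi T /\
  forall T', strong_stationary_time P F X pi T' ->
    forall t, 0 <= t ->
      (P [set w | t%:E < T w] <= P [set w | t%:E < T' w])%E.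

(* Main.v *)
Require Import Defs.
From mathcomp Require Import all_boot all_order all_algebra finmap.
From mathcomp Require Import all_classical all_reals all_analysis.
From mathcomp Require Import measurable_realfun ring.

Set Implicit Arguments.
Unset Strict Implicit.
Unset Printing Implicit Defensive.

Import Order.TTheory GRing.Theory Num.Theory.
Import numFieldNormedType.Exports.

Local Open Scope classical_set_scope.
Local Open Scope ring_scope.

(** Why the theorem is true. At an update a pair forgets its state and takes a fresh
Bernoulli outcome, and all outcomes are independent of all update times. Hence at
any time that is a function of the update times, the pairs that have been updated
at least once carry the product Bernoulli law, independently of that time
([stationary_after_updates]). This shows that the first point of a pair, and the
maximum of the first points, are strong stationary times
([first_point_strong_stationary], [last_first_point_strong_stationary]). The
maximum is at most [t] when every pair has an update before [t]; these events are
independent, each of probability one minus an exponential, which gives its law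
([pr_last_first_point_le]).

For optimality, let [T] be any strong stationary time of one of the processes,
with stationary law [pi]. If [T] is at most [t], then at time [T] the process is
stationary, and by the Markov property it is still stationary at time [t]. So
every state [y] has at time [t] probability at least [pi y] times the probability
that [T] is at most [t] ([strong_stationary_time_bound]). Now take for [y] the
state in which every pair is flipped with respect to the initial one. It can only
be reached when every pair has been updated, and then each pair shows a fresh
outcome, so its probability at time [t] is exactly [pi y] times the probability
that the maximum of the first points is at most [t] ([pr_er_edge_flipped],
[pr_er_graph_flipped]). Dividing by [pi y], which is positive, bounds the
distribution function of [T] by that of the first point or of the maximum
([fastest_of_attained_bound]).

The Markov property holds with respect to the filtration of the whole graph and
the randomization. It is built up as follows. For a Poisson process the past is
independent of the increments ([past_increment_independent]). For one edge, given
the number [k] of updates up to time [s], what is known at time [s] involves only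
the outcomes of index less than [k], and what happens later only the outcomes of
index at least [k] ([edge_filtration_trace], [past_future_independent], [edge_markov]).
Edges are independent, so the transition relations multiply ([er_edge_markov],
[er_graph_markov]). The strong form needed at the random time [T] follows by
rounding [T] up to a grid and using that paths are right continuous. *)

(** * Linear relations between probabilities *)

Section real_valued_probability.
Context {R : realType} {d} {Omega : measurableType d} (P : probability Omega R).
Implicit Types A B D : set Omega.

Definition pr A : R := fine (P A).

Lemma prE A : measurable A -> P A = (pr A)%:E.
Proof. by move=> mA; rewrite fineK// fin_num_measure. Qed.

Lemma pr_ge0 A : 0 <= pr A.
Proof. exact: fine_ge0. Qed.

Lemma pr0 : pr set0 = 0.
Proof. by rewrite /pr measure0. Qed.

Lemma prT : pr setT = 1.
Proof. by rewrite /pr probability_setT. Qed.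

Lemma le_pr A B : measurable A -> measurable B -> A `<=` B -> pr A <= pr B.
Proof.
by move=> mA mB AB; rewrite fine_le ?fin_num_measure// le_measure// inE.
Qed.

Lemma prU A B : measurable A -> measurable B -> A `&` B = set0 ->
  pr (A `|` B) = pr A + pr B.
Proof. by move=> mA mB AB; rewrite /pr measureU// fineD// fin_num_measure. Qed.

Lemma pr_setD A B : measurable A -> measurable B -> B `<=` A ->
  pr (A `\` B) = pr A - pr B.
Proof.
move=> mA mB BA; apply/esym/eqP; rewrite subr_eq; apply/eqP.
rewrite -prU//; first by rewrite setUC setDUK.
- exact: measurableD.
- by rewrite setDE -setIA setICl setI0.
Qed.

Lemma pr_setC A : measurable A -> pr (~` A) = 1 - pr A.
Proof. by move=> mA; rewrite -setTD pr_setD// prT. Qed.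

Lemma pr_setU_le A B : measurable A -> measurable B ->
  pr (A `|` B) <= pr A + pr B.
Proof.
move=> mA mB; have mU := measurableU _ _ mA mB.
rewrite -(setDUK (@subsetUl _ A B)) prU//.
- rewrite lerD2l le_pr//; first exact: measurableD.
  by move=> w [[]].
- exact: measurableD.
- by rewrite -subset0 => w [Aw [_]].
Qed.

Lemma nondecreasing_cvg_pr (F : (set Omega)^nat) :
  (forall n, measurable (F n)) -> nondecreasing_seq F ->
  pr (F n) @[n --> \oo] --> pr (\bigcup_n F n).
Proof.
move=> mF ndF; apply: fine_cvg.
rewrite fineK ?fin_num_measure//; last exact: bigcup_measurable.
by apply: nondecreasing_cvg_mu => //; exact: bigcup_measurable.
Qed.

Lemma nonincreasing_cvg_pr (F : (set Omega)^nat) :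
  (forall n, measurable (F n)) -> nonincreasing_seq F ->
  pr (F n) @[n --> \oo] --> pr (\bigcap_n F n).
Proof.
move=> mF niF; apply: fine_cvg.
rewrite fineK ?fin_num_measure//; last exact: bigcapT_measurable.
apply: nonincreasing_cvg_mu => //; last exact: bigcapT_measurable.
by rewrite ltey_eq fin_num_measure.
Qed.

End real_valued_probability.

Section linear_relations.
Context {R : realType} {d} {Omega : measurableType d} (P : probability Omega R).
Context (I : finType) (D : I -> set Omega) (c : I -> R).
Hypothesis mD : forall i, measurable (D i).

(** Independence of [A] from an event and the Markov property on [A] are both
linear relations between the probabilities of the traces of finitely many fixed
events on [A]. As functions of [A] such relations are closed under proper
differences and increasing unions, so one pi-lambda argument serves for all of
them. *)
Definition null_relation A := \sum_(i : I) c i * pr P (A `&` D i) = 0.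

Lemma null_relation_setD A B : measurable A -> measurable B -> B `<=` A ->
  null_relation A -> null_relation B -> null_relation (A `\` B).
Proof.
rewrite /null_relation => mA mB BA A0 B0.
rewrite -[RHS](subr0 0) -[X in X - _]A0 -[X in _ - X]B0 -sumrB.
apply: eq_bigr => i _; rewrite -mulrBr -pr_setD; first last.
- exact: setSI.
- exact: measurableI.
- exact: measurableI.
congr (_ * pr P _); apply/seteqP; split => w /=.
  by move=> [[Aw nBw] Dw]; split => // -[].
by move=> [[Aw Dw] nBDw]; split => //; split => // Bw; exact: nBDw.
Qed.

Lemma null_relation0 : null_relation set0.
Proof. by apply: big1 => i _; rewrite set0I pr0 mulr0. Qed.

Lemma null_relation_setU A B : measurable A -> measurable B ->
  A `&` B = set0 -> null_relation A -> null_relation B ->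
  null_relation (A `|` B).
Proof.
rewrite /null_relation => mA mB AB A0 B0.
rewrite -[RHS](addr0 0) -[X in X + _]A0 -[X in _ + X]B0 -big_split.
apply: eq_bigr => i _ /=; rewrite -mulrDr -prU ?setIUl//.
- exact: measurableI.
- exact: measurableI.
- by rewrite setIACA AB set0I.
Qed.

Lemma null_relation_bigcup (F : (set Omega)^nat) :
  (forall n, measurable (F n)) -> nondecreasing_seq F ->
  (forall n, null_relation (F n)) -> null_relation (\bigcup_n F n).
Proof.
move=> mF ndF F0.
have : (\sum_(i : I) c i * pr P (F n `&` D i)) @[n --> \oo] -->
       (\sum_(i : I) c i * pr P ((\bigcup_n F n) `&` D i)).
  apply: cvg_big => [|i _]; first exact: add_continuous.
  apply: cvgM; first exact: cvg_cst.
  rewrite setI_bigcupl; apply: nondecreasing_cvg_pr.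
  - by move=> n; exact: measurableI.
  - by move=> m n /ndF/subsetPset mn; apply/subsetPset; exact: setSI.
under eq_fun do rewrite F0.
by move=> cvg0; apply: cvg_unique cvg0 _ => //; exact: cvg_cst.
Qed.

Lemma null_relation_sigma (G : set_system Omega) :
  setI_closed G -> G setT -> G `<=` measurable ->
  G `<=` null_relation -> <<s G >> `<=` null_relation.
Proof.
move=> GI GT Gm G0.
suff : <<s G >> `<=` [set A | measurable A /\ null_relation A] by move=> sub A /sub -[_].
apply: lambda_system_subset => //; last by move=> A GA; split; [exact: Gm|exact: G0].
split => //.
- by split; [exact: Gm|exact: G0].
- move=> A B BA [mA A0] [mB B0]; split; first exact: measurableD.
  exact: null_relation_setD.
- move=> F ndF GF; split.
    by apply: bigcup_measurable => n _; case: (GF n).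
  by apply: null_relation_bigcup => // n; case: (GF n).
Qed.

(** Additivity over the fibres of a discrete random variable lets such a relation
be proved conditionally on the value of that variable. *)
Lemma null_relation_partition (K : countType) (kappa : Omega -> K) A :
  (forall k, measurable (A `&` [set w | kappa w = k])) ->
  (forall k, null_relation (A `&` [set w | kappa w = k])) -> null_relation A.
Proof.
move=> mA A0.
pose B n := A `&` [set w | (choice.pickle (kappa w) < n)%N].
have BS n : B n.+1 = B n `|` (A `&` [set w | choice.pickle (kappa w) = n]).
  rewrite /B -setIUr; congr (_ `&` _); apply/seteqP; split => w /=.
    by rewrite ltnS leq_eqVlt => /orP[/eqP|]; [right|left].
  by case=> [/ltnW //|->].
have Ak n : measurable (A `&` [set w | choice.pickle (kappa w) = n]) /\
            null_relation (A `&` [set w | choice.pickle (kappa w) = n]).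
  have [[k kn]|nk] := pselect (exists k : K, choice.pickle k = n).
    suff -> : [set w | choice.pickle (kappa w) = n] = [set w | kappa w = k] by [].
    by rewrite -kn; apply/seteqP; split => w /= => [/(pcan_inj choice.pickleK)|->].
  suff -> : [set w | choice.pickle (kappa w) = n] = set0.
    by rewrite setI0; split => //; exact: null_relation0.
  by rewrite -subset0 => w kw; apply: nk; exists (kappa w).
have Bn n : measurable (B n) /\ null_relation (B n).
  elim: n => [|n [mB B0]].
    suff -> : B 0%N = set0 by split => //; exact: null_relation0.
    by rewrite -subset0 => w [].
  have [mAn An0] := Ak n; rewrite BS; split; first exact: measurableU.
  apply: null_relation_setU => //; rewrite -subset0 => w [[_ /= wn] [_ /= nw]].
  by rewrite nw ltnn in wn.
have -> : A = \bigcup_n B n.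
  apply/seteqP; split => [w Aw|w [n _ []]//].
  by exists (choice.pickle (kappa w)).+1 => //; split => //=.
apply: null_relation_bigcup => [n||n]; [by case: (Bn n)| |by case: (Bn n)].
move=> m n mn; apply/subsetPset => w [Aw /= wm]; split => //=.
exact: leq_trans wm mn.
Qed.

End linear_relations.

(** * Independence of generated sigma-algebras *)

Section independence.
Context {R : realType} {d} {Omega : measurableType d} (P : probability Omega R).

Lemma sigma_measurable (G : set_system Omega) :
  G `<=` measurable -> <<s G >> `<=` measurable.
Proof. by move=> Gm; apply: smallest_sub => //; exact: sigma_algebra_measurable. Qed.

Lemma sub_sigma (G H : set_system Omega) : G `<=` <<s H >> -> <<s G >> `<=` <<s H >>.
Proof. by move=> GH; apply: smallest_sub => //; exact: smallest_sigma_algebra. Qed.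

Lemma pr_setI_sigma (G : set_system Omega) (D : set Omega) (q : R) :
  setI_closed G -> G setT -> G `<=` measurable -> measurable D ->
  (forall A, G A -> pr P (A `&` D) = pr P A * q) ->
  forall A, <<s G >> A -> pr P (A `&` D) = pr P A * q.
Proof.
move=> GI GT Gm mD GD A sGA.
pose D' (b : bool) := if b then D else setT.
pose c (b : bool) := if b then 1 else - q.
have mD' : forall b, measurable (D' b) by case; [exact: mD|exact: measurableT].
have relE B : null_relation P D' c B <-> pr P (B `&` D) = pr P B * q.
  rewrite /null_relation big_bool /D' /c /= setIT mul1r mulNr (mulrC q).
  by split => [/subr0_eq|->]; rewrite ?subrr.
apply/relE; apply: (null_relation_sigma mD' GI GT Gm) => // B GB.
by apply/relE; exact: GD.
Qed.

Lemma mutually_independent_sub (I : choiceType) (E E' : I -> set_system Omega) :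
  (forall i, E i `<=` E' i) ->
  mutually_independent P E' -> mutually_independent P E.
Proof. by move=> EE' ind J A EA; apply: ind => i iJ; apply: EE'; exact: EA. Qed.

(** The pi-systems are enlarged one index at a time: at each step the product
rule, with all other events held fixed, is a linear relation in the event of the
index that is being treated. *)
Lemma mutually_independent_sigma (I : choiceType) (E : I -> set_system Omega) :
  (forall i, setI_closed (E i)) -> (forall i, E i setT) ->
  (forall i, E i `<=` measurable) -> mutually_independent P E ->
  mutually_independent P (fun i => <<s E i >>).
Proof.
move=> EI ET Em indE.
have sEm i A : <<s E i >> A -> measurable A by exact: sigma_measurable.
suff main (s : seq I) (J : {fset I}) A : (forall i, i \in J -> <<s E i >> (A i)) ->
    (forall i, i \in J -> i \notin s -> E i (A i)) ->
    pr P (\bigcap_(i in [set` J]) A i) = \prod_(i <- J) pr P (A i).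
  by move=> J A EA; apply: (main J) => // i iJ; rewrite iJ.
elim: s J A => [|a s IH] J A sA EA.
  by apply: indE => i iJ; exact: EA.
have [aJ|aJ] := boolP (a \in J); last first.
  apply: IH => // i iJ nis; apply: EA => //; rewrite inE negb_or nis andbT.
  by apply: contraNneq aJ => <-.
rewrite (bigcap_fsetD1 _ aJ) (big_fsetD1 a aJ) /=.
apply: (@pr_setI_sigma (E a)) => //; last exact: sA.
  apply: fin_bigcap_measurable => // i; rewrite /= !inE => /andP[_ iJ].
  exact: (sEm i (A i) (sA i iJ)).
move=> B EB.
pose A' i := if i == a then B else A i.
have A'E i : i \in (J `\ a)%fset -> A' i = A i.
  by rewrite !inE /A' => /andP[/negbTE ->].
have A'a : A' a = B by rewrite /A' eqxx.
have -> : \bigcap_(i in [set` (J `\ a)%fset]) A i =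
          \bigcap_(i in [set` (J `\ a)%fset]) A' i.
  by apply: eq_bigcapr => i /A'E.
have -> : \prod_(i <- (J `\ a)%fset) pr P (A i) =
          \prod_(i <- (J `\ a)%fset) pr P (A' i).
  by apply: eq_big_seq => i /A'E ->.
rewrite -A'a -(bigcap_fsetD1 _ aJ) -(big_fsetD1 a aJ (F := fun i => pr P (A' i))) /=.
apply: IH => i iJ; rewrite /A'; case: eqVneq => [->|ia].
- exact: sub_sigma_algebra.
- exact: (sA i iJ).
- by [].
- by move=> nis; apply: (EA i iJ); rewrite inE negb_or ia.
Qed.

(** Blocks of an independent family are independent. The sigma-algebra of a block
is generated by the pi-system of the finite intersections of events of the block;
such an intersection is stored as a family over all indices that equals [setT]
outside a finite set, so that the intersection of two of them is taken
pointwise. *)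
Lemma mutually_independent_group (I K : choiceType) (g : I -> K)
    (E : I -> set_system Omega) :
  (forall i, setI_closed (E i)) -> (forall i, E i setT) ->
  (forall i, E i `<=` measurable) -> mutually_independent P E ->
  mutually_independent P
    (fun k => <<s \bigcup_(i in [set i | g i = k]) E i >>).
Proof.
move=> EI ET Em indE.
pose E' k A := exists (J : {fset I}) (B : I -> set Omega),
  [/\ forall i, i \in J -> g i = k, forall i, E i (B i),
      forall i, i \notin J -> B i = setT & A = \bigcap_i B i].
have capT (J : {fset I}) (B : I -> set Omega) :
    (forall i, i \notin J -> B i = setT) ->
    \bigcap_i B i = \bigcap_(i in [set` J]) B i.
  move=> BT; apply/seteqP; split => w Bw i // _.
    exact: Bw.
  by have [/Bw//|iJ'] := boolP (i \in J); rewrite BT.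
have E'm k : E' k `<=` measurable.
  move=> A [J [B [_ EB BT ->]]]; rewrite (capT J)//.
  by apply: fin_bigcap_measurable => // i _; exact/Em/EB.
apply: (@mutually_independent_sub _ _ (fun k => <<s E' k >>)).
  move=> k; apply: sub_sigma => A [i /= gi EA].
  apply: sub_sigma_algebra; exists [fset i]%fset.
  exists (fun j => if j == i then A else setT); split.
  - by move=> j; rewrite inE => /eqP ->.
  - by move=> j; case: eqVneq => [->|].
  - by move=> j; rewrite inE => /negbTE ->.
  - apply/seteqP; split => [w Aw j _|w /(_ i Logic.I)]; last by rewrite eqxx.
    by case: eqVneq.
apply: mutually_independent_sigma => //.
- move=> k A A' [J [B [Jk EB BT ->]]] [J' [B' [Jk' EB' BT' ->]]].
  exists (J `|` J')%fset, (fun i => B i `&` B' i); split.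
  + by move=> i; rewrite inE => /orP[/Jk|/Jk'].
  + by move=> i; exact: EI.
  + by move=> i; rewrite inE negb_or => /andP[/BT -> /BT' ->]; rewrite setIT.
  + by rewrite bigcapI.
- move=> k; exists fset0, (fun=> setT); split => //.
  by apply/seteqP.
move=> L A EA.
have /choice[J] : forall k, exists J : {fset I}, exists B : I -> set Omega,
    k \in L -> [/\ forall i, i \in J -> g i = k, forall i, E i (B i),
      forall i, i \notin J -> B i = setT & A k = \bigcap_i B i].
  move=> k; have [/EA[J [B EB]]|] := boolP (k \in L); first by exists J, B.
  by exists fset0, (fun=> setT).
move=> /choice[B JB].
pose B' i := B (g i) i.
have AB k : k \in L -> A k = \bigcap_(i in [set` J k]) B' i.
  move=> kL; have [Jk _ BT ->] := JB k kL; rewrite (capT (J k))//.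
  by apply: eq_bigcapr => i /= /Jk gi; rewrite /B' gi.
have EB' k i : k \in L -> i \in J k -> E i (B' i).
  by move=> kL iJ; have [/(_ i iJ) gi EB _ _] := JB k kL; rewrite /B' gi.
have -> : \bigcap_(k in [set` L]) A k =
          \bigcap_(i in [set` (\bigcup_(k <- L) J k)%fset]) B' i.
  apply/seteqP; split => [w Aw i /= /bigfcupP[k /andP[kL _] iJ]|w Bw k /= kL].
    by have := Aw k kL; rewrite AB//; exact.
  rewrite AB// => i /= iJ; apply: Bw; apply/bigfcupP; exists k => //.
  by rewrite kL.
rewrite indE; last first.
  by move=> i /bigfcupP[k /andP[kL _] iJ]; exact: (EB' k).
rewrite (partition_disjoint_bigfcup _ _ (K := L)).
  by apply: eq_big_seq => k kL; rewrite AB// indE// => i; exact: EB'.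
move=> k l kL lL kl; apply/fdisjointP => i iJk; apply/negP => iJl.
have [/(_ i iJk) gk _ _ _] := JB k kL; have [/(_ i iJl) gl _ _ _] := JB l lL.
by move: kl; rewrite -gk -gl eqxx.
Qed.

End independence.

(** * Events of discrete random variables *)

Section generated_sigma_algebra.
Context {T : pointedType}.
Implicit Types G : set_system T.

Lemma sigma_setI G A B : <<s G >> A -> <<s G >> B -> <<s G >> (A `&` B).
Proof. exact: (@measurableI _ (g_sigma_algebraType G)). Qed.

Lemma sigma_setD G A B : <<s G >> A -> <<s G >> B -> <<s G >> (A `\` B).
Proof. exact: (@measurableD _ (g_sigma_algebraType G)). Qed.

Lemma sigma_set0 G : <<s G >> set0.
Proof. exact: (@measurable0 _ (g_sigma_algebraType G)). Qed.

Lemma sigma_setT G : <<s G >> setT.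
Proof. exact: (@measurableT _ (g_sigma_algebraType G)). Qed.

Lemma sigma_constant G (Q : Prop) : <<s G >> [set w | Q].
Proof.
have [q|nq] := pselect Q.
  by rewrite (_ : [set w | Q] = setT); [exact: sigma_setT|apply/seteqP; split].
by rewrite (_ : [set w | Q] = set0); [exact: sigma_set0|rewrite -subset0].
Qed.

Lemma sigma_bigcap G (F : (set T)^nat) :
  (forall n, <<s G >> (F n)) -> <<s G >> (\bigcap_n F n).
Proof. exact: (@bigcapT_measurable _ (g_sigma_algebraType G)). Qed.

Lemma sigma_bigcup G (K : countType) (F : K -> set T) :
  (forall k, <<s G >> (F k)) -> <<s G >> (\bigcup_k F k).
Proof.
apply: (@countable_bigcupT_measurable _ (g_sigma_algebraType G)).
exact: countableP.
Qed.

Lemma sigma_fin_bigcap G (K : choiceType) (J : {fset K}) (F : K -> set T) :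
  (forall k, k \in J -> <<s G >> (F k)) -> <<s G >> (\bigcap_(k in [set` J]) F k).
Proof. by move=> JF; apply: (@fin_bigcap_measurable _ (g_sigma_algebraType G)). Qed.

Lemma sigma_level_preimage G (S : countType) (X : T -> S) (B : set S) :
  (forall k, <<s G >> [set w | X w = k]) -> <<s G >> (X @^-1` B).
Proof.
move=> GX.
have -> : X @^-1` B = \bigcup_k [set w | X w = k /\ B k].
  by apply/seteqP; split => w => [BX|[k _ [/= <-]]//]; exists (X w).
apply: sigma_bigcup => k; have [Bk|nBk] := pselect (B k).
  suff -> : [set w | X w = k /\ B k] = [set w | X w = k] by exact: GX.
  by apply/seteqP; split => [w []|w].
suff -> : [set w | X w = k /\ B k] = set0 by exact: sigma_set0.
by rewrite -subset0 => w [].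
Qed.

Lemma sigma_level_map2 G (S1 S2 S : countType) (X : T -> S1) (Y : T -> S2)
    (f : S1 -> S2 -> S) :
  (forall k, <<s G >> [set w | X w = k]) -> (forall k, <<s G >> [set w | Y w = k]) ->
  forall k, <<s G >> [set w | f (X w) (Y w) = k].
Proof.
move=> GX GY k.
rewrite (_ : [set w | _] = (fun w => (X w, Y w)) @^-1` [set p | f p.1 p.2 = k])//.
apply: sigma_level_preimage => -[a b].
rewrite (_ : [set w | _] = [set w | X w = a] `&` [set w | Y w = b]).
  exact: sigma_setI.
by apply/seteqP; split => w /= [-> ->].
Qed.

Lemma level_g_sigma_algebra_preimage d (S : measurableType d) (X : T -> S) B :
  measurable B -> g_sigma_algebra_preimage X (X @^-1` B).
Proof. by move=> mB; exists B => //; rewrite setTI. Qed.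

End generated_sigma_algebra.

Section random_variable_events.
Context {R : realType} {d} {Omega : measurableType d} {P : probability Omega R}.

Lemma preimage_nat_level (X : Omega -> nat) k :
  g_sigma_algebra_preimage X [set w | X w = k].
Proof. exact: (@level_g_sigma_algebra_preimage _ _ _ X [set k]). Qed.

Lemma preimage_nat_sub G (X : Omega -> nat) :
  (forall k, <<s G >> [set w | X w = k]) -> g_sigma_algebra_preimage X `<=` <<s G >>.
Proof. by move=> GX _ [B _ <-]; rewrite setTI; exact: sigma_level_preimage. Qed.

Lemma gsa_preimage_setI d' (S : measurableType d') (X : Omega -> S) :
  setI_closed (g_sigma_algebra_preimage X).
Proof. exact: (@measurableI _ (g_sigma_algebra_preimageType X)). Qed.

Lemma gsa_preimage_setT d' (S : measurableType d') (X : Omega -> S) :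
  g_sigma_algebra_preimage X setT.
Proof. exact: (@measurableT _ (g_sigma_algebra_preimageType X)). Qed.

Lemma measurable_level d' (S : measurableType d') (X : {RV P >-> S}) k :
  measurable [set k] -> measurable [set w | X w = k].
Proof. by move=> mk; exact: (measurable_funPTI X mk). Qed.

Lemma gsa_preimage_measurable d' (S : measurableType d') (X : {RV P >-> S}) :
  g_sigma_algebra_preimage X `<=` measurable.
Proof. by move=> _ [C mC <-]; rewrite setTI; exact: (measurable_funPTI X mC). Qed.

End random_variable_events.

(** * Past and increments of a Poisson process *)

Section poisson.
Context {R : realType} {d} {Omega : measurableType d} (P : probability Omega R).
Context (rate : R) (N : R -> {RV P >-> nat}) (HN : poisson_process rate N).

Definition poisson_past (s : R) : set_system Omega :=
  <<s \bigcup_(r in [set r | 0 <= r <= s]) g_sigma_algebra_preimage (N r) >>.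

(** The finitely many times are sorted, with [0] in front and [s], [t] at the
end. The values of the process at these times are sums of increments before [s],
which are independent of the increment over the last interval. *)
Lemma past_increment_on_grid (s t : R) (rs : seq R) (A B : set Omega) :
  0 <= s -> s <= t -> (forall r, r \in rs -> 0 <= r <= s) ->
  <<s \bigcup_(r in [set` rs]) g_sigma_algebra_preimage (N r) >> A ->
  g_sigma_algebra_preimage (fun w => (N t w - N s w)%N) B ->
  pr P (A `&` B) = pr P A * pr P B.
Proof.
move=> s0 st rss sA gB.
pose q := sort <=%O rs.
pose L := 0 :: rcons q s.
have qs r : r \in q -> 0 <= r <= s by rewrite mem_sort; exact: rss.
have sL : sorted <=%O L.
  rewrite /L /= rcons_path le_path_sortedE sort_le_sorted andbT.
  apply/andP; split; first by apply/allP => r /qs /andP[].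
  by have := mem_last 0 q; rewrite inE => /orP[/eqP ->//|/qs /andP[]].
have sizeL : size L = (size q).+2 by rewrite /= size_rcons.
(* Beyond the end of [L] the default value [t] keeps the sequence nondecreasing, and its
   first occurrence closes the interval from [s] to [t]. *)
pose tau i := nth t L i.
have Lt r : r \in L -> r <= t.
  rewrite inE mem_rcons inE => /orP[/eqP ->|/orP[/eqP ->//|/qs /andP[_ rs']]].
    exact: le_trans st.
  exact: le_trans st.
have ndtau : nondecreasing_seq tau.
  apply/nondecreasing_seqP => i; rewrite /tau.
  have [iL|Li] := ltnP i.+1 (size L); first exact: (sortedP t sL).
  rewrite [leRHS]nth_default//; have [iL|Li'] := ltnP i (size L).
    by apply: Lt; exact: mem_nth.
  by rewrite nth_default.
have tauq : tau (size q).+1 = s by rewrite /tau /= nth_rcons ltnn eqxx.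
have taut : tau (size q).+2 = t by rewrite /tau nth_default// sizeL.
pose inc i w := (N (tau i.+1) w - N (tau i) w)%N.
pose E i := g_sigma_algebra_preimage (inc i).
have tau0 i : 0 <= tau i by apply: (@le_trans _ _ (tau 0%N)); [rewrite /tau|exact: ndtau].
have indE : mutually_independent P E.
  by apply: (poisson_independent_increments HN) => //; exact: tau0.
have Em i : E i `<=` measurable.
  rewrite -[X in _ `<=` X](sigma_algebra_id (sigma_algebra_measurable Omega)).
  apply: preimage_nat_sub; apply: sigma_level_map2 => k;
    by apply: sub_sigma_algebra; apply: measurable_level.
have indE' := mutually_independent_group (g := fun i : nat => (i <= size q)%N)
  (fun i => gsa_preimage_setI (X := inc i)) (fun i => gsa_preimage_setT (inc i)) Em indE.
pose E' b := <<s \bigcup_(i in [set i | (i <= size q)%N = b]) E i >>.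
have level i : (i <= (size q).+1)%N -> forall k, E' true [set w | N (tau i) w = k].
  elim: i => [_ k|i IH iq].
    rewrite (_ : [set w | _] = [set w | 0%N = k]); first exact: sigma_constant.
    by under eq_set do rewrite (poisson_start HN).
  have Ni w : N (tau i.+1) w = (N (tau i) w + inc i w)%N.
    by rewrite /inc subnKC// (poisson_nondecreasing HN)//; exact: (ndtau _ _ (leqnSn i)).
  rewrite (_ : N (tau i.+1) = (fun w => (N (tau i) w + inc i w)%N) :> (_ -> _)).
    apply: sigma_level_map2; first by apply: IH; exact: ltnW.
    by move=> k; apply: sub_sigma_algebra; exists i => //=; exact: preimage_nat_level.
  exact/funext.
have E'A : E' true A.
  move: A sA; apply: sub_sigma => A [r /= rrs].
  have rL : (index r L <= (size q).+1)%N.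
    by rewrite -ltnS -sizeL index_mem inE mem_rcons inE mem_sort rrs !orbT.
  have taur : tau (index r L) = r.
    by rewrite /tau nth_index// -index_mem sizeL ltnS.
  by apply: preimage_nat_sub => k; rewrite -taur; exact: level.
have E'B : E' false B.
  apply: sub_sigma_algebra; exists (size q).+1; first by rewrite /= ltnn.
  by rewrite /E /inc tauq taut.
have := indE' [fset true; false]%fset (fun b => if b then A else B).
rewrite bigcap_fset !big_fsetU1 ?inE//= !big_seq_fset1; apply.
by case=> _.
Qed.

(** The events that depend on finitely many times before [s] form a pi-system that
generates the whole past. *)
Lemma past_increment_independent (s t : R) (A B : set Omega) :
  0 <= s -> s <= t -> poisson_past s A ->
  g_sigma_algebra_preimage (fun w => (N t w - N s w)%N) B ->
  pr P (A `&` B) = pr P A * pr P B.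
Proof.
move=> s0 st pA gB.
pose G A := exists2 rs : seq R, forall r, r \in rs -> 0 <= r <= s &
  <<s \bigcup_(r in [set` rs]) g_sigma_algebra_preimage (N r) >> A.
have sub (rs rs' : seq R) : {subset rs <= rs'} ->
    <<s \bigcup_(r in [set` rs]) g_sigma_algebra_preimage (N r) >> `<=`
    <<s \bigcup_(r in [set` rs']) g_sigma_algebra_preimage (N r) >>.
  move=> rsrs'; apply: sub_sigma => C [r /= rrs NC].
  by apply: sub_sigma_algebra; exists r => //=; exact: rsrs'.
apply: (@pr_setI_sigma _ _ _ P G).
- move=> C C' [rs rss sC] [rs' rss' sC']; exists (rs ++ rs').
    by move=> r; rewrite mem_cat => /orP[/rss|/rss'].
  apply: sigma_setI; [apply: sub sC|apply: sub sC'] => r;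
    by rewrite mem_cat => ->; rewrite ?orbT.
- by exists [::] => //; exact: sigma_setT.
- by move=> C [rs _]; apply: sigma_measurable => {}C [r _]; exact: gsa_preimage_measurable.
- move: gB => [C _ <-]; rewrite setTI.
  rewrite -[measurable](sigma_algebra_id (sigma_algebra_measurable Omega)).
  apply: sigma_level_preimage; apply: sigma_level_map2 => k;
    by apply: sub_sigma_algebra; apply: measurable_level.
- by move=> C [rs rss sC]; exact: (past_increment_on_grid s0 st rss).
- move: A pA; apply: sub_sigma => C [r /= r0s NC].
  apply: sub_sigma_algebra; exists [:: r] => [r'|]; first by rewrite inE => /eqP ->.
  by apply: sub_sigma_algebra; exists r => //=; rewrite inE.
Qed.

Lemma pr_no_increment (s t : R) : 0 < rate -> 0 <= s -> s <= t ->
  pr P [set w | (N t w - N s w)%N = 0%N] = expR (- rate * (t - s)).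
Proof.
move=> rate0 s0; rewrite le_eqVlt => /orP[/eqP <-|st].
  rewrite subrr mulr0 expR0 -[RHS](prT P); congr (pr P _).
  by apply/seteqP; split => w //= _; rewrite subnn.
rewrite /pr (poisson_increment_law HN)//= /poisson_pmf mulr_gt0 ?subr_gt0//.
by rewrite expr0 fact0 invr1 !mul1r mulNr.
Qed.

End poisson.

(** * Markov property of a single edge *)

(** Common to all the measurability statements about edges: it is applied with
[m] the number of updates and [u] the outcomes, once per sigma-algebra. *)
Lemma sigma_updated_state (T : pointedType) (G : set_system T) (m : T -> nat)
    (u : nat -> T -> bool) (x : T -> bool) (b : bool) :
  (forall k, <<s G >> [set w | m w = k]) ->
  (forall k, <<s G >> [set w | (k < m w)%N /\ u k w = b]) ->
  <<s G >> [set w | x w = b] ->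
  <<s G >> [set w | (if m w is k.+1 then u k w else x w) = b].
Proof.
move=> Gm Gu Gx.
rewrite (_ : [set w | _] = \bigcup_k ([set w | m w = k] `&`
    if k is j.+1 then [set w | (j < m w)%N /\ u j w = b] else [set w | x w = b])).
  by apply: sigma_bigcup => -[|k]; apply: sigma_setI.
apply/seteqP; split => w /= => [mw|[k _ []]].
  exists (m w) => //; split => //; move: mw; case E: (m w) => [|k] /= mk; rewrite ?E //.
by move=> /= ->; case: k => // k [].
Qed.

(** A single edge with a deterministic initial state [x0]. *)
Section edge_markov.
Context {R : realType} {d} {Omega : measurableType d} (P : probability Omega R).
Context (rate p : R) (N : R -> {RV P >-> nat}) (U : nat -> {RV P >-> bool}) (x0 : bool).
Hypothesis rate0 : 0 < rate.
Hypothesis HN : poisson_process rate N.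
Hypothesis HU : forall k b, pr P [set w | U k w = b] = bernoulli_pmf p b.
Hypothesis indNU : mutually_independent P (fun i : option nat =>
  if i is Some k then g_sigma_algebra_preimage (U k) else sigma_process N).

Definition edge_state (t : R) (w : Omega) : bool :=
  if N t w is k.+1 then U k w else x0.

Definition edge_filtration (s : R) : set_system Omega :=
  <<s [set A | (exists r k, [/\ 0 <= r, r <= s & A = [set w | N r w = k]]) \/
    (exists r k b, [/\ 0 <= r, r <= s & A = [set w | (k < N r w)%N /\ U k w = b]])] >>.

Definition outcomes_before k :=
  <<s \bigcup_(j in [set j | (j < k)%N]) g_sigma_algebra_preimage (U j) >>.

Definition outcomes_from k :=
  <<s \bigcup_(j in [set j | (k <= j)%N]) g_sigma_algebra_preimage (U j) >>.

Lemma sigma_process_measurable : sigma_process N `<=` measurable.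
Proof. by apply: sigma_measurable => A [r _]; exact: gsa_preimage_measurable. Qed.

(** Update times, the first [k] outcomes and the later outcomes are three blocks
of the independent family. *)
Lemma updates_outcomes_independent k A V W :
  sigma_process N A -> outcomes_before k V -> outcomes_from k W ->
  pr P (A `&` (V `&` W)) = pr P A * (pr P V * pr P W).
Proof.
move=> NA UV UW.
pose g (i : option nat) : nat :=
  if i is Some j then (if (j < k)%N then 1%N else 2%N) else 0%N.
pose E (i : option nat) :=
  if i is Some k then g_sigma_algebra_preimage (U k) else sigma_process N.
have EI i : setI_closed (E i).
  by case: i => [j|]; [exact: gsa_preimage_setI|exact: sigma_setI].
have ET i : E i setT by case: i => [j|]; [exact: gsa_preimage_setT|exact: sigma_setT].
have Em i : E i `<=` measurable.
  by case: i => [j|]; [exact: gsa_preimage_measurable|exact: sigma_process_measurable].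
have := mutually_independent_group (g := g) EI ET Em indNU.
move=> /(_ (0 |` (1 |` [fset 2]))%N%fset (nth setT [:: A; V; W])).
rewrite bigcap_fset !big_fsetU1 ?inE//= !big_seq_fset1; apply => i.
rewrite !inE => /or3P[] /eqP -> /=.
- by apply: sub_sigma_algebra; exists None.
- move: V UV; apply: sub_sigma => V [j /= jk UV].
  by apply: sub_sigma_algebra; exists (Some j); rewrite //= jk.
- move: W UW; apply: sub_sigma => W [j /= jk UW].
  by apply: sub_sigma_algebra; exists (Some j); rewrite //= ltnNge jk.
Qed.

(** On the event that there are [k] updates up to time [s], the events known at
time [s] are in the sigma-algebra generated by this pi-system. *)
Definition past_and_outcomes s k : set_system Omega :=
  [set B | exists A V, [/\ poisson_past N s A, outcomes_before k V & B = A `&` V]].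

Lemma past_sigma_process s : poisson_past N s `<=` sigma_process N.
Proof.
apply: sub_sigma => A [r /= /andP[r0 _] NA].
by apply: sub_sigma_algebra; exists r.
Qed.

Lemma increment_sigma_process s t : 0 <= s -> 0 <= t ->
  g_sigma_algebra_preimage (fun w => (N t w - N s w)%N) `<=` sigma_process N.
Proof.
move=> s0 t0; apply: preimage_nat_sub; apply: sigma_level_map2 => k.
- by apply: sub_sigma_algebra; exists t => //; exact: preimage_nat_level.
- by apply: sub_sigma_algebra; exists s => //; exact: preimage_nat_level.
Qed.

Lemma outcomes_measurable k :
  outcomes_before k `<=` measurable /\ outcomes_from k `<=` measurable.
Proof. by split; apply: sigma_measurable => A [j _]; exact: gsa_preimage_measurable. Qed.

(** The reason for the Markov property: once the number [k] of updates is fixed,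
the future of the edge is a function of the increments of the counting process
and of the outcomes with index at least [k]. *)
Lemma past_future_independent (s t : R) k (B I W : set Omega) : 0 <= s -> s <= t ->
  <<s past_and_outcomes s k >> B ->
  g_sigma_algebra_preimage (fun w => (N t w - N s w)%N) I ->
  outcomes_from k W ->
  pr P (B `&` (I `&` W)) = pr P B * (pr P I * pr P W).
Proof.
move=> s0 st HB gI UW.
have t0 : 0 <= t by exact: le_trans st.
have NI := increment_sigma_process s0 t0 gI.
have [Vm Wm] := outcomes_measurable k.
apply: (pr_setI_sigma (G := past_and_outcomes s k)) => //.
- move=> _ _ [A [V [pA UV ->]]] [A' [V' [pA' UV' ->]]].
  exists (A `&` A'), (V `&` V'); split; last by rewrite setIACA.
    exact: sigma_setI.
  exact: sigma_setI.
- by exists setT, setT; rewrite setIT; split => //; exact: sigma_setT.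
- move=> _ [A [V [pA UV ->]]]; apply: measurableI; last exact: Vm.
  exact: sigma_process_measurable (past_sigma_process pA).
- by apply: measurableI; [exact: sigma_process_measurable|exact: Wm].
- move=> _ [A [V [pA UV ->]]].
  have NA := past_sigma_process pA.
  have UT : outcomes_from k setT by exact: sigma_setT.
  have := updates_outcomes_independent NA UV UT; rewrite setIT prT mulr1 => ->.
  have := updates_outcomes_independent (sigma_setI NA NI) UV UW.
  rewrite (past_increment_independent HN s0 st pA gI) setIACA => ->.
  by rewrite mulrACA.
Qed.

(** The filtration records the outcome of update [j] only if that update has
happened, which on the event of exactly [k] updates means [j < k]; so the trace
does not see the future outcomes. *)
Lemma edge_filtration_trace s k A : 0 <= s -> edge_filtration s A ->
  <<s past_and_outcomes s k >> (A `&` [set w | N s w = k]).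
Proof.
move=> s0.
have pastG B : poisson_past N s B -> <<s past_and_outcomes s k >> B.
  move=> pB; apply: sub_sigma_algebra; exists B, setT.
  by rewrite setIT; split => //; exact: sigma_setT.
have NG r j : 0 <= r -> r <= s -> <<s past_and_outcomes s k >> [set w | N r w = j].
  move=> r0 rs; apply: pastG; apply: sub_sigma_algebra; exists r; last exact: preimage_nat_level.
  by rewrite /= r0 rs.
have DG : <<s past_and_outcomes s k >> [set w | N s w = k] by exact: NG.
move: A; apply: smallest_sub; first split.
- by rewrite set0I; exact: sigma_set0.
- move=> A AG; rewrite (_ : _ `&` _ = [set w | N s w = k] `\` (A `&` [set w | N s w = k])).
    exact: sigma_setD.
  apply/seteqP; split => w /=; first by move=> [[_ nA] ->]; split => // -[].
  by move=> [Nk nA]; split => //; split => // Aw; exact: nA.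
- by move=> A AG; rewrite setI_bigcupl; exact: sigma_bigcup.
move=> A [[r [j [r0 rs ->]]]|[r [j [b [r0 rs ->]]]]].
  by apply: sigma_setI => //; exact: NG.
have [jk|kj] := ltnP j k; last first.
  rewrite (_ : _ `&` _ = set0); first exact: sigma_set0.
  rewrite -subset0 => w /= [[jN _] Nk].
  by have := poisson_nondecreasing HN w r0 rs; rewrite Nk leqNgt (leq_ltn_trans kj jN).
rewrite (_ : [set w | _] = (N r @^-1` [set m | (j < m)%N]) `&` [set w | U j w = b])//.
apply: sigma_setI => //; apply: sigma_setI.
  by apply: sigma_level_preimage => m; exact: NG.
apply: sub_sigma_algebra; exists setT, [set w | U j w = b].
rewrite setTI; split => //; first exact: sigma_setT.
apply: sub_sigma_algebra; exists j => //.
exact: (@level_g_sigma_algebra_preimage _ _ _ (U j) [set b]).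
Qed.

Definition no_update_prob (u : R) := expR (- rate * u).

Lemma past_and_outcomes_measurable s k :
  <<s past_and_outcomes s k >> `<=` measurable.
Proof.
apply: sigma_measurable => _ [A [V [pA UV ->]]].
apply: measurableI; last exact: (outcomes_measurable k).1.
exact: sigma_process_measurable (past_sigma_process pA).
Qed.

Lemma edge_state_measurable t y : 0 <= t ->
  measurable [set w | edge_state t w = y].
Proof.
move=> t0.
rewrite -[measurable](sigma_algebra_id (sigma_algebra_measurable Omega)).
apply: (@sigma_updated_state _ _ (N t) (fun k w => U k w) (fun=> x0)) => [k|k|].
- by apply: sub_sigma_algebra; apply: measurable_level.
- apply: sigma_setI; last by apply: sub_sigma_algebra; apply: measurable_level.
  apply: (@sigma_level_preimage _ _ _ (N t) [set m | (k < m)%N]) => m.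
  by apply: sub_sigma_algebra; apply: measurable_level.
- exact: sigma_constant.
Qed.

(** Either there is no update between [s] and [t], and the state is kept, or there
are some, and the state at time [t] is the last outcome, which has law
[bernoulli_pmf p] and is independent of [B]. *)
Lemma edge_markov_trace (s t : R) k y B : 0 <= s -> s <= t ->
  <<s past_and_outcomes s k >> B -> B `<=` [set w | N s w = k] ->
  pr P (B `&` [set w | edge_state t w = y]) =
  no_update_prob (t - s) * pr P (B `&` [set w | edge_state s w = y]) +
  (1 - no_update_prob (t - s)) * bernoulli_pmf p y * pr P B.
Proof.
move=> s0 st HB Bk; have t0 : 0 <= t by exact: le_trans st.
have Bm := past_and_outcomes_measurable HB.
pose I l := [set w | (N t w - N s w)%N = l].
have gI l : g_sigma_algebra_preimage (fun w => (N t w - N s w)%N) (I l).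
  exact: preimage_nat_level.
have Im l : measurable (I l).
  exact: sigma_process_measurable (increment_sigma_process s0 t0 (gI l)).
have Nst w : (N s w <= N t w)%N by exact: (poisson_nondecreasing HN).
have pr_stay : pr P (I 0%N) = no_update_prob (t - s) by exact: pr_no_increment.
have Xtm := edge_state_measurable y t0.
have Xsm := edge_state_measurable y s0.
set Xt := [set w | edge_state t w = y]; set Xs := [set w | edge_state s w = y].
have UT : outcomes_from k setT by exact: sigma_setT.
have splitI C : measurable C -> pr P C = pr P (C `&` I 0%N) + pr P (C `&` ~` I 0%N).
  move=> mC; rewrite -prU -?setIUr ?setUCr ?setIT//.
  - exact: measurableI.
  - by apply: measurableI => //; exact: measurableC.
  - by rewrite setIACA setICr setI0.
have BIC : pr P (B `&` ~` I 0%N) = pr P B * (1 - no_update_prob (t - s)).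
  rewrite mulrBr mulr1 -pr_stay.
  have := past_future_independent s0 st HB (gI 0%N) UT.
  rewrite setIT prT mulr1 => <-.
  by rewrite [in RHS](splitI B)// addrAC subrr add0r.
have BXs : <<s past_and_outcomes s k >> (B `&` Xs).
  case: k {UT} Bk HB => [|k] Bk HB.
    have [xy|xy] := eqVneq x0 y.
      rewrite (_ : _ `&` _ = B)//; apply/seteqP; split => [w []//|w Bw].
      by split => //; rewrite /Xs /= /edge_state (Bk _ Bw).
    rewrite (_ : _ `&` _ = set0); first exact: sigma_set0.
    rewrite -subset0 => w [Bw]; rewrite /Xs /= /edge_state (Bk _ Bw).
    exact/eqP.
  rewrite (_ : _ `&` _ = B `&` [set w | U k w = y]).
    apply: sigma_setI => //; apply: sub_sigma_algebra.
    exists setT, [set w | U k w = y]; rewrite setTI; split => //; first exact: sigma_setT.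
    apply: sub_sigma_algebra; exists k => //=.
    exact: (@level_g_sigma_algebra_preimage _ _ _ (U k) [set y]).
  by apply/seteqP; split => w /= [Bw]; rewrite /Xs /= /edge_state (Bk _ Bw).
rewrite (splitI (B `&` Xt)); last exact: measurableI.
congr (_ + _).
  have := past_future_independent s0 st BXs (gI 0%N) UT.
  rewrite setIT prT mulr1 pr_stay mulrC => <-; congr (pr P _).
  rewrite -!setIA; congr (_ `&` _); apply/seteqP; split => w /= [] XX I0; split => //;
    move: XX; rewrite /Xt /Xs /= /edge_state;
    by have /eqP := I0; rewrite subn_eq0 => NN; rewrite (@anti_leq (N t w) (N s w)) ?NN ?Nst.
(* Given the number of updates after [s], the index of the last outcome is fixed. *)
transitivity (bernoulli_pmf p y * pr P (B `&` ~` I 0%N)); last first.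
  by rewrite BIC; ring.
pose D (b : bool) := if b then Xt else setT.
pose c (b : bool) := if b then 1 else - bernoulli_pmf p y.
have mD : forall b, measurable (D b) by case; [exact: Xtm|exact: measurableT].
have BICm : measurable (B `&` ~` I 0%N) by apply: measurableI => //; exact: measurableC.
have := @null_relation_partition _ _ _ P _ D c mD _
  (fun w => (N t w - N s w)%N) (B `&` ~` I 0%N).
rewrite {2}/null_relation big_bool /D /c setIT mul1r mulNr => rel.
apply/subr0_eq; rewrite setIAC; apply: rel.
  by move=> l; exact: (measurableI _ _ BICm (Im l)).
case=> [|l].
  rewrite (_ : _ `&` _ = set0); first exact: null_relation0.
  by rewrite -setIA setICl setI0.
rewrite (_ : _ `&` _ = B `&` I l.+1); last first.
  apply/seteqP; split => w /=; first by move=> [[]].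
  by move=> [Bw Il]; split => //; split => //; rewrite /I /= Il.
rewrite /null_relation big_bool /= setIT mul1r mulNr.
have -> : B `&` I l.+1 `&` Xt = B `&` (I l.+1 `&` [set w | U (k + l)%N w = y]).
  have Nt w : B w -> I l.+1 w -> N t w = (k + l).+1.
    by move=> Bw Il; rewrite -(subnK (Nst w)) Il (Bk _ Bw) addSn addnC.
  rewrite -setIA; apply/seteqP; split => w /= [Bw [Il]]; rewrite /Xt /= /edge_state;
    by rewrite (Nt w Bw Il).
rewrite (past_future_independent s0 st HB (gI l.+1)); last first.
  apply: sub_sigma_algebra; exists (k + l)%N; first exact: leq_addr.
  exact: (@level_g_sigma_algebra_preimage _ _ _ (U (k + l)%N) [set y]).
have := past_future_independent s0 st HB (gI l.+1) UT.
rewrite setIT prT mulr1 => ->; rewrite HU.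
by rewrite mulrA [bernoulli_pmf p y * _]mulrC subrr.
Qed.

(** The number of updates up to [s] is not bounded, so the cases are put together
by countable additivity. *)
Lemma edge_markov (s t : R) y A : 0 <= s -> s <= t -> edge_filtration s A ->
  pr P (A `&` [set w | edge_state t w = y]) =
  no_update_prob (t - s) * pr P (A `&` [set w | edge_state s w = y]) +
  (1 - no_update_prob (t - s)) * bernoulli_pmf p y * pr P A.
Proof.
move=> s0 st FA; have t0 : 0 <= t by exact: le_trans st.
pose D (i : 'I_3) := nth setT
  [:: [set w | edge_state t w = y]; [set w | edge_state s w = y]] i.
pose c (i : 'I_3) := nth 0
  [:: 1; - no_update_prob (t - s); - ((1 - no_update_prob (t - s)) * bernoulli_pmf p y)] i.
have mD : forall i, measurable (D i).
  by move=> [[|[|[|//]]] i3]; rewrite /D /=;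
    [exact: edge_state_measurable|exact: edge_state_measurable|exact: measurableT].
have relE B : null_relation P D c B <->
    pr P (B `&` [set w | edge_state t w = y]) =
    no_update_prob (t - s) * pr P (B `&` [set w | edge_state s w = y]) +
    (1 - no_update_prob (t - s)) * bernoulli_pmf p y * pr P B.
  rewrite /null_relation !big_ord_recl big_ord0 /D /c /= setIT mul1r !mulNr addr0 -opprD.
  by split => [/subr0_eq|->]; rewrite ?subrr.
have tr k := edge_filtration_trace (k := k) s0 FA.
apply/relE; apply: (null_relation_partition mD (kappa := N s)) => k.
  exact: past_and_outcomes_measurable (tr k).
by apply/relE; apply: edge_markov_trace (tr k) _ => // w [].
Qed.

End edge_markov.

(** * Transition relations and finite families of events *)

Section kernel_relation.
Context {R : realType} {d} {Omega : measurableType d} (P : probability Omega R).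
Context (S : finType) (Y : set Omega) (X : S -> set Omega) (h : S -> R).
Hypothesis mY : measurable Y.
Hypothesis mX : forall x, measurable (X x).

(** The Markov property at a fixed pair of times, with [X x] the event of being in
state [x] at the first time, [Y] an event at the second one and [h x] the
transition probability, holds on [B] when this relation does. *)
Definition kernel_relation (B : set Omega) :=
  pr P (B `&` Y) = \sum_(x : S) pr P (B `&` X x) * h x.

Lemma kernel_relation_sigma (G : set_system Omega) :
  setI_closed G -> G setT -> G `<=` measurable ->
  G `<=` kernel_relation -> <<s G >> `<=` kernel_relation.
Proof.
move=> GI GT Gm GR.
pose D (i : unit + S) := if i is inr x then X x else Y.
pose c (i : unit + S) := if i is inr x then h x else -1.
have mD : forall i, measurable (D i) by case=> [[]|x]; [exact: mY|exact: mX].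
have relE B : null_relation P D c B <-> kernel_relation B.
  rewrite /null_relation /kernel_relation big_sumType /=.
  rewrite (big_pred1 tt); last by case.
  rewrite /c /D mulN1r addrC.
  under eq_bigr do rewrite mulrC.
  by split => [/subr0_eq ->|->]; rewrite ?subrr.
move=> B GB; apply/relE; apply: (null_relation_sigma mD GI GT Gm) => // A GA.
by apply/relE; exact: GR.
Qed.

End kernel_relation.

Section finite_intersections.
Context {R : realType} {d} {Omega : measurableType d} (P : probability Omega R).

Lemma bigcap_fin_fset (I : finType) (A : I -> set Omega) :
  \bigcap_i A i = \bigcap_(i in [set` seq_fset tt (index_enum I)]) A i.
Proof.
apply/seteqP; split => w Aw i // _; first exact: Aw.
by apply: Aw; have := seq_fsetE tt (index_enum I) i; rewrite mem_index_enum.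
Qed.

Lemma measurable_bigcap_fin (I : finType) (A : I -> set Omega) :
  (forall i, measurable (A i)) -> measurable (\bigcap_i A i).
Proof. by move=> mA; rewrite bigcap_fin_fset; apply: fin_bigcap_measurable. Qed.

Lemma pr_bigcap_fin (I : finType) (E : I -> set_system Omega) (A : I -> set Omega) :
  mutually_independent P E -> (forall i, E i (A i)) ->
  pr P (\bigcap_i A i) = \prod_i pr P (A i).
Proof.
move=> indE EA; rewrite bigcap_fin_fset /pr indE; last by move=> i _; exact: EA.
apply: perm_big; apply: perm_trans (seq_fset_perm _ _) _.
by rewrite undup_id ?index_enum_uniq.
Qed.

Lemma mutually_independent_inj (I J : choiceType) (h : I -> J)
    (E : J -> set_system Omega) : injective h ->
  mutually_independent P E -> mutually_independent P (E \o h).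
Proof.
move=> hI indE L A EA.
(* As [h] is injective, each of these intersections is a single [A i] or [setT]. *)
pose A' j := \bigcap_(i in [set i | h i = j]) A i.
have A'h i : A' (h i) = A i.
  by apply/seteqP; split => [w /(_ i erefl)//|w Aw i' /= /hI ->].
have -> : \bigcap_(i in [set` L]) A i = \bigcap_(j in [set` (h @` L)%fset]) A' j.
  apply/seteqP; split => w Aw; last first.
    by move=> i /= iL; rewrite -A'h; apply: Aw; rewrite /= in_imfset.
  by move=> j /imfsetP[i /= iL ->]; rewrite A'h; exact: Aw.
rewrite indE => [|j /imfsetP[i /= iL ->]]; last by rewrite A'h; exact: EA.
rewrite big_imfset/=; last by move=> ? ? _ _; exact: hI.
by apply: eq_bigr => i _; rewrite A'h.
Qed.

End finite_intersections.

(** * State of a right-continuous process at a random time *)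

Section time_grid.
Context {R : realType} {Omega : Type} (T : Omega -> \bar R).
Hypothesis T0 : forall w, (0 <= T w)%E.

(** The event that [T] is rounded up to [i * delta] on the grid of mesh [delta];
the first cell is the event that [T] is zero. *)
Definition grid_cell (delta : R) (i : nat) : set Omega :=
  [set w | (T w <= (i%:R * delta)%:E)%E] `\`
  (if i is k.+1 then [set w | (T w <= (k%:R * delta)%:E)%E] else set0).

Lemma grid_cell_bounds delta i w : 0 <= delta -> grid_cell delta i w ->
  [/\ T w \is a fin_num, fine (T w) <= i%:R * delta &
      i%:R * delta <= fine (T w) + delta].
Proof.
move=> d0 [/= Ti nTi].
have Tfin : T w \is a fin_num.
  by rewrite ge0_fin_numE// (le_lt_trans Ti)// ltry.
have Te : T w = (fine (T w))%:E by rewrite fineK.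
split=> //; first by rewrite -lee_fin -Te.
case: i Ti nTi => [|k] Ti nTi; first by rewrite mul0r addr_ge0// fine_ge0.
rewrite -natr1 mulrDl mul1r lerD2r ltW// -lte_fin -Te ltNge.
exact/negP.
Qed.

Lemma grid_cell_ex delta w : 0 < delta -> (T w < +oo)%E ->
  exists i, grid_cell delta i w.
Proof.
move=> d0 Tw.
have Te : T w = (fine (T w))%:E by rewrite fineK// ge0_fin_numE.
have [i0 Ti0] : exists i, (T w <= (i%:R * delta)%:E)%E.
  exists (Num.bound (fine (T w) / delta)).
  rewrite Te lee_fin -ler_pdivrMr// ltW// archi_boundP//.
  by rewrite divr_ge0 ?fine_ge0// ltW.
have ex : exists i, (T w <= (i%:R * delta)%:E)%E by exists i0.
case: (ex_minnP ex) => i Ti mini; exists i; split => //.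
case: i Ti mini => [|k] Ti mini //= Tk.
by have := mini k Tk; rewrite ltnn.
Qed.

(** Rounding up approaches [T] from the right, so by right continuity the state at
the rounded time is eventually the state at [T]. *)
Lemma grid_cell_settles (S : Type) (X : R -> Omega -> S) w :
  (T w < +oo)%E ->
  (\forall r \near (fine (T w))^'+, X r w = X (fine (T w)) w) ->
  exists2 eps : R, 0 < eps & forall delta i, 0 <= delta -> delta < eps ->
    grid_cell delta i w -> X (i%:R * delta) w = X (fine (T w)) w.
Proof.
rewrite /at_right near_withinE => Tw /nbhs_ballP[/= e e0 He].
exists e => // delta i d0 de wi.
have [_ Ti iT] := grid_cell_bounds d0 wi.
have [->//|ne] := eqVneq (i%:R * delta) (fine (T w)).
apply: He; last by rewrite lt_neqAle eq_sym ne.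
rewrite /ball /= distrC ger0_norm ?subr_ge0//.
by rewrite ltrBlDl (le_lt_trans iT)// ltrD2l.
Qed.

End time_grid.

Section stopped_state.
Context {R : realType} {Omega : pointedType} (G : set_system Omega).
Context (T : Omega -> \bar R) (S : countType) (X : R -> Omega -> S).
Hypothesis T0 : forall w, (0 <= T w)%E.
Hypothesis GT : forall r : R, 0 <= r -> <<s G >> [set w | (T w <= r%:E)%E].
Hypothesis GX : forall r x, 0 <= r -> <<s G >> [set w | X r w = x].
Hypothesis rcX : forall w r, 0 <= r -> \forall s \near r^'+, X s w = X r w.

Lemma grid_cell_sigma delta i : 0 <= delta -> <<s G >> (grid_cell T delta i).
Proof.
move=> d0; apply: sigma_setD; first by apply: GT; rewrite mulr_ge0.
by case: i => [|k]; [exact: sigma_set0|apply: GT; rewrite mulr_ge0].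
Qed.

(** The state at [T] is the limit, eventually constant, of the states at the times
obtained by rounding [T] up, which take countably many values. *)
Lemma stopped_state_sigma t x : 0 <= t ->
  <<s G >> [set w | (T w <= t%:E)%E /\ X (fine (T w)) w = x].
Proof.
move=> t0; pose delta m : R := m.+1%:R^-1.
have d0 m : 0 < delta m by rewrite invr_gt0.
rewrite (_ : [set w | _] = [set w | (T w <= t%:E)%E] `&` \bigcup_M \bigcap_m \bigcup_i
    (grid_cell T (delta (M + m)%N) i `&` [set w | X (i%:R * delta (M + m)%N) w = x])).
  apply: sigma_setI; first exact: GT.
  apply: sigma_bigcup => M; apply: sigma_bigcap => m; apply: sigma_bigcup => i.
  apply: sigma_setI; first by apply: grid_cell_sigma; rewrite ltW.
  by apply: GX; rewrite mulr_ge0// ltW.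
have settle w : (T w <= t%:E)%E -> exists M, forall m i, (M <= m)%N ->
    grid_cell T (delta m) i w -> X (i%:R * delta m) w = X (fine (T w)) w.
  move=> Tw; have Tfin : (T w < +oo)%E by rewrite (le_lt_trans Tw)// ltry.
  have [e e0 He] := grid_cell_settles T0 Tfin (rcX w (fine_ge0 (T0 w))).
  have [M _ HM] := near_infty_natSinv_lt (PosNum e0).
  by exists M => m i Mm; apply: He; [rewrite ltW|exact: HM].
apply/seteqP; split => w /=.
  move=> [Tw Xw]; split => //; have [M HM] := settle w Tw.
  exists M => // m _.
  have [i wi] := grid_cell_ex T0 (d0 (M + m)%N) (le_lt_trans Tw (ltry t)).
  by exists i => //; split => //=; rewrite HM// leq_addr.
move=> [Tw [M _ HM]]; split => //; have [M' HM'] := settle w Tw.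
have [i _ [wi /= <-]] := HM M' I.
by rewrite HM'// leq_addl.
Qed.

End stopped_state.

(** * Strong stationary times *)

Lemma measurable_of_level_le {R : realType} d (Omega : measurableType d)
    (T : Omega -> \bar R) : (forall w, (0 <= T w)%E) ->
  (forall r : R, 0 <= r -> measurable [set w | (T w <= r%:E)%E]) -> measurable_fun setT T.
Proof.
move=> T0 mT _; apply: (measurability _ (ErealGenOInfty.measurableE R)) => //.
move=> _ [_ [r ->] <-]; rewrite setTI.
have [r0|r0] := leP 0 r.
  rewrite (_ : _ @^-1` _ = ~` [set w | (T w <= r%:E)%E]).
    by apply: measurableC; exact: mT.
  apply/seteqP; split => w /=; rewrite in_itv/= andbT.
    by rewrite ltNge => /negP.
  by move=> /negP; rewrite -ltNge.
rewrite (_ : _ @^-1` _ = setT)//; apply/seteqP; split => w //= _.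
by rewrite in_itv/= andbT (lt_le_trans _ (T0 w))// lte_fin.
Qed.

Section stationary_time_criteria.
Context {R : realType} {d} {Omega : measurableType d} (P : probability Omega R).
Context (F : R -> set_system Omega).

Lemma stopping_time_randomized (T : Omega -> \bar R) :
  (forall t, F t `<=` measurable) -> (forall w, (0 <= T w)%E) ->
  (forall t : R, 0 <= t -> F t [set w | (T w <= t%:E)%E]) ->
  randomized_stopping_time P F T.
Proof.
move=> Fm T0 FT; split => //.
  by apply: measurable_of_level_le => // r r0; exact: Fm (FT r r0).
(* A stopping time of the filtration itself is randomized by the trivial sigma-algebra. *)
exists [set A | A = set0 \/ A = setT]; split.
- split; first by left.
    by move=> A [->|->]; [right; rewrite setD0|left; rewrite setDv].
  move=> A A01; have [[m Am]|nA] := pselect (exists m, A m = setT).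
    by right; apply/seteqP; split => // w _; exists m => //; rewrite Am.
  left; rewrite -subset0 => w [m _]; case: (A01 m) => [->//|Am].
  by case: nA; exists m.
- by move=> A [->|->].
- move=> A B _ [->|->]; first by rewrite setI0 measure0 mule0.
  by rewrite setIT probability_setT mule1.
- by move=> t t0; apply: sub_sigma_algebra; left; exact: FT.
Qed.

Lemma strong_stationary_timeI (S : countType) (X : R -> Omega -> S) (pi : S -> R)
    (T : Omega -> \bar R) :
  adapted F X -> randomized_stopping_time P F T ->
  (forall t y, 0 <= t ->
    pr P [set w | (T w <= t%:E)%E /\ X (fine (T w)) w = y] =
    pr P [set w | (T w <= t%:E)%E] * pi y) ->
  strong_stationary_time P F X pi T.
Proof.
move=> adX rT PT; split => // t y t0; rewrite /cond_prob.
have sub : [set w | (T w <= t%:E)%E] `<=` [set w | (T w < +oo)%E].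
  by move=> w /= Tw; rewrite (le_lt_trans Tw)// ltry.
have -> : [set w | (T w <= t%:E)%E] `&` [set w | (T w < +oo)%E] = [set w | (T w <= t%:E)%E].
  exact/setIidPl.
have -> : [set w | (T w <= t%:E)%E /\ X (fine (T w)) w = y] `&` [set w | (T w < +oo)%E] =
          [set w | (T w <= t%:E)%E /\ X (fine (T w)) w = y].
  by apply/setIidPl => w [/sub].
by rewrite -/(pr P _) PT// mulrAC.
Qed.

End stationary_time_criteria.

(** From a strong stationary time on, the process stays stationary. Hence, for a
Markov process started anywhere, a state [y] is reached at time [t] with
probability at least [pi y] times the probability that [T] is at most [t]. *)
Section strong_stationary_time_bound.
Context {R : realType} {d} {Omega : measurableType d} (P : probability Omega R).
Context (S : finType) (F : R -> set_system Omega) (X : R -> Omega -> S)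
  (pi : S -> R) (T : Omega -> \bar R) (y : S) (h : R -> S -> R).
Hypothesis F_measurable : forall t, F t `<=` measurable.
Hypothesis F_setI : forall t, setI_closed (F t).
Hypothesis F_setT : forall t, F t setT.
Hypothesis F_mono : forall s t, s <= t -> F s `<=` F t.
Hypothesis rcX : forall w r, 0 <= r -> \forall s \near r^'+, X s w = X r w.
Hypothesis markov : forall s t A, 0 <= s -> s <= t -> F s A ->
  kernel_relation P [set w | X t w = y] (fun x => [set w | X s w = x]) (h (t - s)) A.
Hypothesis h01 : forall u x, 0 <= u -> 0 <= h u x <= 1.
Hypothesis stationary : forall u, 0 <= u -> \sum_(x : S) pi x * h u x = pi y.
Hypothesis sst : strong_stationary_time P F X pi T.

Let adX : adapted F X. Proof. by case: sst. Qed.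
Let T0 w : (0 <= T w)%E. Proof. by case: sst => _ []. Qed.
Let mX r x : 0 <= r -> measurable [set w | X r w = x].
Proof. by move=> r0; apply: F_measurable; exact: adX. Qed.
Let mT (r : R) : measurable [set w | (T w <= r%:E)%E].
Proof.
case: sst => _ [Tm _ _] _; rewrite -[X in measurable X]setTI.
exact: emeasurable_fun_infty_c.
Qed.

Let W t x := [set w | (T w <= t%:E)%E /\ X (fine (T w)) w = x].

Let mW t x : 0 <= t -> measurable (W t x).
Proof.
move=> t0; rewrite -[measurable](sigma_algebra_id (sigma_algebra_measurable Omega)).
apply: stopped_state_sigma => // r *; apply: sub_sigma_algebra; [exact: mT|exact: mX].
Qed.

(** The conditioning on [T] being finite drops out, as both sides vanish when [T]
is infinite almost surely. *)
Lemma stationary_at_time t x : 0 <= t ->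
  pr P (W t x) = pr P [set w | (T w <= t%:E)%E] * pi x.
Proof.
move=> t0; have [_ _ /(_ t x t0)] := sst; rewrite /cond_prob.
have Toom : measurable [set w | (T w < +oo)%E].
  case: sst => _ [Tm _ _] _; rewrite -[X in measurable X]setTI.
  exact: emeasurable_fun_infty_o.
have sub : [set w | (T w <= t%:E)%E] `<=` [set w | (T w < +oo)%E].
  by move=> w /= Tw; rewrite (le_lt_trans Tw)// ltry.
rewrite [X in fine (P X) / _ = _](_ : _ = W t x); last first.
  by apply/setIidPl => w [/sub].
rewrite [X in _ = fine (P X) / _ * _ -> _](_ : _ = [set w | (T w <= t%:E)%E]); last first.
  exact/setIidPl.
rewrite -/(pr P _) -/(pr P _) -/(pr P _).
have [Too0 _|Too0] := eqVneq (pr P [set w | (T w < +oo)%E]) 0.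
  have z A : measurable A -> A `<=` [set w | (T w < +oo)%E] -> pr P A = 0.
    by move=> mA AT; apply/eqP; rewrite eq_le pr_ge0 andbT -Too0 le_pr.
  by rewrite !z ?mul0r//; [exact: mW|move=> w [/sub]].
by rewrite mulrAC => /(mulIf _); apply; rewrite invr_eq0.
Qed.

Lemma sum_grid_cell delta m Z : 0 <= delta -> measurable Z ->
  \sum_(i < m.+1) pr P (grid_cell T delta i `&` Z) =
  pr P ([set w | (T w <= (m%:R * delta)%:E)%E] `&` Z).
Proof.
move=> d0 mZ; elim: m => [|m IH]; first by rewrite big_ord1 /grid_cell setD0.
rewrite big_ord_recr /= IH -prU.
- congr (pr P _); rewrite -setIUl; congr (_ `&` _); rewrite /grid_cell setDUK//.
  move=> w /= Tw; rewrite (le_trans Tw)// lee_fin ler_wpM2r//.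
  by rewrite ler_nat.
- exact: measurableI.
- by apply: measurableI => //; exact: measurableD.
- by rewrite -subset0 => w [[Tw _] [[_ nTw] _]].
Qed.

Lemma stationary_grid_cell delta i x : 0 <= delta ->
  pr P (grid_cell T delta i `&` W (i%:R * delta) x) = pr P (grid_cell T delta i) * pi x.
Proof.
move=> d0; have i0 : 0 <= i%:R * delta by rewrite mulr_ge0.
have -> : grid_cell T delta i `&` W (i%:R * delta) x =
    W (i%:R * delta) x `\` (if i is k.+1 then W (k%:R * delta) x else set0).
  rewrite /grid_cell /W; case: i i0 => [|k] i0; apply/seteqP; split => w /=.
  - by move=> [_ ?]; split.
  - by move=> [[Tw Xw] _]; split => //; split.
  - by move=> [[_ nT] ?]; split => // -[].
  - by move=> [[Tw Xw] nT]; split => //; split => // Tk; exact: nT.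
case: i i0 => [|k] i0; first by rewrite /grid_cell !setD0 stationary_at_time.
have k0 : 0 <= k%:R * delta by rewrite mulr_ge0.
have sub : [set w | (T w <= (k%:R * delta)%:E)%E] `<=`
           [set w | (T w <= (k.+1%:R * delta)%:E)%E].
  by move=> w /= Tw; rewrite (le_trans Tw)// lee_fin ler_wpM2r// ler_nat.
rewrite !pr_setD//; [|exact: mW|exact: mW|by move=> w [/sub]].
by rewrite !stationary_at_time// mulrBl.
Qed.

(** Independent randomization does not affect the Markov property, because the
transition relation is multiplied on both sides by the probability of the
randomizing event. *)
Lemma randomized_markov (G : set_system Omega) s t A :
  sigma_algebra setT G -> G `<=` measurable ->
  (forall A B, sigma_infty F A -> G B -> P (A `&` B) = (P A * P B)%E) ->
  0 <= s -> s <= t -> <<s F s `|` G >> A ->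
  kernel_relation P [set w | X t w = y] (fun x => [set w | X s w = x]) (h (t - s)) A.
Proof.
move=> sG Gm indG s0 st FGA; have t0 := le_trans s0 st.
have GI : setI_closed G.
  by rewrite -(sigma_algebra_id sG); exact: sigma_setI.
have GT : G setT by rewrite -(sigma_algebra_id sG); exact: sigma_setT.
pose Q : set_system Omega := [set B | exists A C, [/\ F s A, G C & B = A `&` C]].
apply: (@kernel_relation_sigma _ _ _ P _ _ _ _ _ _ Q).
- exact: mX.
- by move=> x; exact: mX.
- move=> _ _ [B [C [FB GC ->]]] [B' [C' [FB' GC' ->]]].
  exists (B `&` B'), (C `&` C'); split; last by rewrite setIACA.
    exact: F_setI.
  exact: GI.
- by exists setT, setT; rewrite setIT.
- move=> _ [B [C [FB GC ->]]]; apply: measurableI; last exact: Gm.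
  exact: F_measurable FB.
- move=> _ [B [C [FB GC ->]]]; rewrite /kernel_relation.
  have infty r Z : 0 <= r -> F r Z -> sigma_infty F Z.
    by move=> r0 FZ; apply: sub_sigma_algebra; exists r.
  have ind r x : 0 <= r -> pr P (B `&` C `&` [set w | X r w = x]) =
      pr P (B `&` [set w | X r w = x]) * pr P C.
    move=> r0; rewrite setIAC /pr indG//; last first.
      by apply: sigma_setI; [exact: (infty s)|apply: (infty r) => //; exact: adX].
    rewrite fineM//; apply: fin_num_measure; last exact: Gm.
    by apply: measurableI; [exact: F_measurable FB|exact: mX].
  rewrite ind// (markov s0 st FB) mulr_suml; apply: eq_bigr => x _.
  by rewrite ind// mulrAC.
- move: A FGA; apply: sub_sigma => A [FA|GA]; apply: sub_sigma_algebra.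
    by exists A, setT; rewrite setIT.
  by exists setT, A; rewrite setTI.
Qed.

(** With this mesh, [t] is itself a point of the grid, so that the cells up to index
[j.+1] exhaust the event that [T] is at most [t]. *)
Let delta (t : R) (j : nat) := t / j.+1%:R.

(** The event that rounding [T] up on the grid changes the observed state. *)
Let bad t j := [set w | exists2 i, (i < j.+2)%N & grid_cell T (delta t j) i w /\
  X (i%:R * delta t j) w <> X (fine (T w)) w].

Let grid_le t j i : 0 <= t -> (i < j.+2)%N -> i%:R * delta t j <= t.
Proof.
move=> t0 ij; rewrite /delta mulrCA ler_piMr// ler_pdivrMr// mul1r ler_nat.
by rewrite -ltnS.
Qed.

Let delta_ge0 t j : 0 <= t -> 0 <= delta t j.
Proof. by move=> t0; rewrite divr_ge0. Qed.

Let mcell e i : measurable (grid_cell T e i).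
Proof. by apply: measurableD => //; case: i. Qed.

Let mbad t j : 0 <= t -> measurable (bad t j).
Proof.
move=> t0; have d0 := delta_ge0 j t0.
rewrite (_ : bad t j = \bigcup_(i : 'I_j.+2) \bigcup_(x : S) (grid_cell T (delta t j) i `&`
    (W t x `\` [set w | X (i%:R * delta t j) w = x]))).
  apply: countable_bigcupT_measurable => [|i]; first exact: countableP.
  apply: countable_bigcupT_measurable => [|x]; first exact: countableP.
  apply: measurableI => //; apply: measurableD; first exact: mW.
  by apply: mX; rewrite mulr_ge0.
apply/seteqP; split => w.
  move=> [i ij [wi nX]]; exists (Ordinal ij) => //; exists (X (fine (T w)) w) => //.
  split => //; split => //; split => //; move: wi => [/= Ti _].
  by rewrite (le_trans Ti)// lee_fin grid_le.
move=> [i _ [x _ [wi [[_ <-] nX]]]]; exists i => //.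
Qed.

Lemma bad_cvg0 t : 0 <= t -> pr P (bad t j) @[j --> \oo] --> (0 : R).
Proof.
move=> t0; pose B j := \bigcup_k bad t (j + k)%N.
have mB j : measurable (B j) by apply: bigcup_measurable => k _; exact: mbad.
(* By [grid_cell_settles] no outcome lies in infinitely many of the events [bad]. *)
have B0 : \bigcap_j B j = set0.
  rewrite -subset0 => w Bw.
  have Tw : (T w < +oo)%E.
    by have [k _ [i _ [/(grid_cell_bounds T0 (delta_ge0 _ t0))[Tfin _ _] _]]] := Bw 0%N I;
      rewrite ltey_eq Tfin.
  have [e e0 He] := grid_cell_settles T0 Tw (rcX w (fine_ge0 (T0 w))).
  have te : 0 < e / (t + 1) by rewrite divr_gt0// ltr_wpDl.
  have [M _ HM] := near_infty_natSinv_lt (PosNum te).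
  have [k _ [i _ [wi]]] := Bw M I; apply.
  apply: He wi; first exact: delta_ge0.
  have := HM (M + k)%N (leq_addr _ _); rewrite /= ltr_pdivlMr ?ltr_wpDl//.
  by apply: le_lt_trans; rewrite /delta mulrC ler_wpM2l// lerDl.
have cvB : pr P (B j) @[j --> \oo] --> (0 : R).
  rewrite -(pr0 P) -B0; apply: nonincreasing_cvg_pr => //.
  move=> j k jk; apply/subsetPset => w [l _ wl]; exists (k - j + l)%N => //.
  by rewrite addnA subnKC.
apply: squeeze_cvgr (cvg_cst _) cvB; apply: nearW => j; rewrite pr_ge0 /=.
apply: le_pr => //; first exact: mbad.
by move=> w wj; exists 0%N => //; rewrite addn0.
Qed.

(** Strong Markov property by discretization. On the cell [i] the Markov property is
applied at the grid time. If the state there is the state at [T], its law given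
the cell is [pi], and the law at time [t] is again [pi] by stationarity. The
error is at most [#|S|] times the probability of [bad], which tends to [0]. *)
Lemma strong_stationary_time_bound t : 0 <= t ->
  pr P [set w | (T w <= t%:E)%E] * pi y <= pr P [set w | X t w = y].
Proof.
move=> t0; have mXt := mX y t0.
suff bnd j : pr P [set w | (T w <= t%:E)%E] * pi y - #|S|%:R * pr P (bad t j) <=
    pr P [set w | X t w = y].
  rewrite -[leLHS]subr0 -[X in _ - X](mulr0 #|S|%:R).
  have lim : pr P [set w | (T w <= t%:E)%E] * pi y - #|S|%:R * pr P (bad t j) @[j --> \oo]
      --> pr P [set w | (T w <= t%:E)%E] * pi y - #|S|%:R * (0 : R).
    apply: cvgB; first exact: cvg_cst.
    by apply: cvgM; [exact: cvg_cst|exact: bad_cvg0].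
  by apply: (ler_cvg_to lim (cvg_cst _)); apply: nearW.
have d0 := delta_ge0 j t0.
have tE : t = j.+1%:R * delta t j by rewrite /delta mulrC divfK.
have [_ [_ _ [G [sG Gm indG FGT]]] _] := sst.
have FGmono r s A : r <= s -> <<s F r `|` G >> A -> <<s F s `|` G >> A.
  move=> rs; apply: sub_sigma => B [FB|GB]; apply: sub_sigma_algebra.
    by left; exact: F_mono FB.
  by right.
have FGcell i : <<s F (i%:R * delta t j) `|` G >> (grid_cell T (delta t j) i).
  apply: sigma_setD; first by apply: FGT; rewrite mulr_ge0.
  case: i => [|k]; first exact: sigma_set0.
  apply: (FGmono (k%:R * delta t j)); last by apply: FGT; rewrite mulr_ge0.
  by rewrite ler_wpM2r// ler_nat.
have cellW i : (i < j.+2)%N ->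
    pr P (grid_cell T (delta t j) i) * pi y -
      #|S|%:R * pr P (grid_cell T (delta t j) i `&` bad t j) <=
    pr P (grid_cell T (delta t j) i `&` [set w | X t w = y]).
  move=> ij; set s := i%:R * delta t j; set C := grid_cell _ _ _.
  have s0 : 0 <= s by rewrite mulr_ge0.
  have st : s <= t by exact: grid_le.
  have mC : measurable C by exact: mcell.
  have mb := mbad j t0.
  rewrite (randomized_markov sG Gm indG s0 st (FGcell i)).
  have ts0 : 0 <= t - s by rewrite subr_ge0.
  rewrite -(stationary ts0) mulr_sumr mulr_natl -sumr_const -sumrB.
  apply: ler_sum => x _; have /andP[h0 h1] := h01 x ts0.
  rewrite mulrA -stationary_grid_cell//.
  have mCW : measurable (C `&` W s x) by apply: measurableI => //; exact: mW.
  have mCX : measurable (C `&` [set w | X s w = x]) by apply: measurableI => //; exact: mX.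
  have mCb : measurable (C `&` bad t j) by exact: measurableI.
  have le1 : pr P (C `&` W s x) <= pr P (C `&` [set w | X s w = x]) + pr P (C `&` bad t j).
    apply: le_trans (pr_setU_le P mCX mCb); apply: le_pr => //.
      exact: measurableU.
    move=> w [Cw [Tw Xw]]; have [Xsw|Xsw] := pselect (X s w = x); first by left.
    by right; split => //; exists i => //; split => //; rewrite Xw.
  rewrite lerBlDr (le_trans (ler_wpM2r h0 le1))// mulrDl lerD2l.
  by rewrite ler_piMr// pr_ge0.
have sumcell Z : measurable Z ->
    \sum_(i < j.+2) pr P (grid_cell T (delta t j) i `&` Z) =
    pr P ([set w | (T w <= t%:E)%E] `&` Z).
  by move=> mZ; rewrite sum_grid_cell// -tE.
apply: (@le_trans _ _ (pr P ([set w | (T w <= t%:E)%E] `&` [set w | X t w = y]))); last first.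
  by apply: le_pr => //; exact: measurableI.
rewrite -(sumcell _ mXt); apply: (@le_trans _ _ (\sum_(i < j.+2)
    (pr P (grid_cell T (delta t j) i) * pi y -
     #|S|%:R * pr P (grid_cell T (delta t j) i `&` bad t j)))); last first.
  by apply: ler_sum => i _; exact: cellW.
rewrite sumrB -mulr_suml -mulr_sumr sumcell; last exact: mbad.
have := sumcell _ measurableT; rewrite setIT => <-.
under [in leRHS]eq_bigr do rewrite -[grid_cell _ _ _]setIT.
rewrite lerD2l lerN2 ler_wpM2l// le_pr//; [exact: measurableI (mT t) (mbad j t0)|exact: mbad].
Qed.

End strong_stationary_time_bound.

(** A single state [y] of positive stationary mass for which the bound is an
equality is enough for optimality. *)
Lemma fastest_of_attained_bound {R : realType} {d} {Omega : measurableType d}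
    (P : probability Omega R) (S : finType) (F : R -> set_system Omega)
    (X : R -> Omega -> S) (pi : S -> R) (T : Omega -> \bar R) (y : S) :
  strong_stationary_time P F X pi T -> 0 < pi y ->
  (forall T' t, strong_stationary_time P F X pi T' -> 0 <= t ->
    pr P [set w | (T' w <= t%:E)%E] * pi y <= pr P [set w | X t w = y]) ->
  (forall t, 0 <= t ->
    pr P [set w | X t w = y] = pr P [set w | (T w <= t%:E)%E] * pi y) ->
  fastest_time_to_stationarity P F X pi T.
Proof.
move=> sstT piy bound PX; split => // T' sstT' t t0.
have level T1 : strong_stationary_time P F X pi T1 ->
    P [set w | (t%:E < T1 w)%E] = (1 - pr P [set w | (T1 w <= t%:E)%E])%:E.
  move=> [_ [mT1 _ _] _].
  have mle : measurable [set w | (T1 w <= t%:E)%E].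
    by rewrite -[X in measurable X]setTI; exact: emeasurable_fun_infty_c.
  rewrite -pr_setC// -prE; last exact: measurableC.
  congr (P _); apply/seteqP; split => w /=; first by rewrite ltNge => /negP.
  by move=> /negP; rewrite -ltNge.
rewrite (level T sstT) (level T' sstT') lee_fin lerD2l lerN2.
by rewrite -(ler_pM2r piy) -PX//; exact: bound.
Qed.

(** * Markov property of the dynamic graph *)

Section dynamic_er.
Context {R : realType} (alpha beta : R) (n : nat) {d} {Omega : measurableType d}
  (P : probability Omega R) (N : vpair n -> R -> {RV P >-> nat})
  (U : vpair n -> nat -> {RV P >-> bool}) (X0 : vpair n -> {RV P >-> bool})
  (sigma : {ffun vpair n -> bool}).
Hypotheses (alpha0 : 0 < alpha) (beta0 : 0 < beta) (n2 : (2 <= n)%N).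
Hypothesis HD : dynamic_er_updates alpha beta N U.
Hypothesis H0 : P [set w | er_graph N U X0 0 w = sigma] = 1%E.

Local Notation rate := (update_rate alpha beta n).
Local Notation p := (edge_prob alpha beta n).
Local Notation HN e := (update_times_poisson HD e).

Lemma natB1_gt0 : 0 < n%:R - 1 :> R.
Proof. by rewrite subr_gt0 ltr1n. Qed.

Lemma rate_gt0 : 0 < rate.
Proof. by rewrite /update_rate addr_gt0// divr_gt0// natB1_gt0. Qed.

Lemma edge_prob_gt0 : 0 < p.
Proof. by rewrite /edge_prob divr_gt0// addr_gt0// mulr_gt0// natB1_gt0. Qed.

Lemma edge_prob_lt1 : p < 1.
Proof.
have na0 : 0 < (n%:R - 1) * alpha by rewrite mulr_gt0// natB1_gt0.
by rewrite /edge_prob ltr_pdivrMr ?addr_gt0// mul1r ltrDl.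
Qed.

Lemma bernoulli_edge_prob_gt0 b : 0 < bernoulli_pmf p b.
Proof. by case: b; rewrite /= ?subr_gt0 ?edge_prob_gt0 ?edge_prob_lt1. Qed.

Lemma pr_outcome e k b : pr P [set w | U e k w = b] = bernoulli_pmf p b.
Proof.
have ptrue : pr P [set w | U e k w = true] = p by rewrite /pr (update_outcome_law HD).
case: b => //=; rewrite -ptrue -pr_setC; last exact: measurable_level.
by congr (pr P _); apply/seteqP; split => w /=; case: (U e k w).
Qed.

Lemma edge_updates_independent e : mutually_independent P (fun i : option nat =>
  if i is Some k then g_sigma_algebra_preimage (U e k) else sigma_process (N e)).
Proof.
pose h (i : option nat) : vpair n + vpair n * nat :=
  if i is Some k then inr (e, k) else inl e.
have hI : injective h by move=> [k|] [l|] //= [->].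
apply: mutually_independent_sub (mutually_independent_inj hI (updates_independent HD)).
by case=> [k|] A.
Qed.

(** The edge with its deterministic initial state; it agrees with the given one
almost surely. *)
Local Notation Y e := (edge_state (N e) (U e) (sigma e)).
Local Notation past_edge e := (edge_filtration (N e) (U e)).

(** All that concerns the pair [e] except its initial state. *)
Definition edge_sigma e : set_system Omega :=
  <<s sigma_process (N e) `|` \bigcup_k g_sigma_algebra_preimage (U e k) >>.

Lemma edge_sigma_measurable e : edge_sigma e `<=` measurable.
Proof.
apply: sigma_measurable => A [|[k _]]; last exact: gsa_preimage_measurable.
exact: sigma_process_measurable.
Qed.

Lemma edges_independent : mutually_independent P edge_sigma.
Proof.
pose owner (i : vpair n + vpair n * nat) := match i with inl e => e | inr (e, _) => e end.
apply: mutually_independent_sub (mutually_independent_group (g := owner) _ _ _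
  (updates_independent HD)).
- move=> e; apply: sub_sigma => A [NA|[k _ UA]]; apply: sub_sigma_algebra.
    by exists (inl e).
  by exists (inr (e, k)).
- by case=> [e|[e k]]; [exact: sigma_setI|exact: gsa_preimage_setI].
- by case=> [e|[e k]]; [exact: sigma_setT|exact: gsa_preimage_setT].
- by case=> [e|[e k]]; [exact: sigma_process_measurable|exact: gsa_preimage_measurable].
Qed.

Lemma edge_sigma_N e r k : 0 <= r -> edge_sigma e [set w | N e r w = k].
Proof.
move=> r0; apply: sub_sigma_algebra; left; apply: sub_sigma_algebra.
by exists r => //; exact: preimage_nat_level.
Qed.

Lemma edge_sigma_U e k b : edge_sigma e [set w | U e k w = b].
Proof.
apply: sub_sigma_algebra; right; exists k => //.
exact: (@level_g_sigma_algebra_preimage _ _ _ (U e k) [set b]).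
Qed.

Lemma edge_sigma_NU e r k b : 0 <= r ->
  edge_sigma e [set w | (k < N e r w)%N /\ U e k w = b].
Proof.
move=> r0; apply: sigma_setI; last exact: edge_sigma_U.
apply: (@sigma_level_preimage _ _ _ (N e r) [set m | (k < m)%N]) => m.
exact: edge_sigma_N.
Qed.

Lemma past_edge_sigma e s : past_edge e s `<=` edge_sigma e.
Proof.
apply: sub_sigma => A [[r [k [r0 _ ->]]]|[r [k [b [r0 _ ->]]]]].
  exact: edge_sigma_N.
exact: edge_sigma_NU.
Qed.

Lemma edge_state_sigma e t b : 0 <= t -> edge_sigma e [set w | Y e t w = b].
Proof.
move=> t0; apply: (@sigma_updated_state _ _ (N e t) (fun k w => U e k w) (fun=> sigma e)).
- by move=> k; exact: edge_sigma_N.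
- by move=> k; exact: edge_sigma_NU.
- exact: sigma_constant.
Qed.

Definition edge_kernel (u : R) (a b : bool) : R :=
  no_update_prob rate u * (a == b)%:R + (1 - no_update_prob rate u) * bernoulli_pmf p b.

Definition graph_kernel (u : R) (x y : {ffun vpair n -> bool}) : R :=
  \prod_e edge_kernel u (x e) (y e).

Lemma edge_kernel_relation e s t b A : 0 <= s -> s <= t -> past_edge e s A ->
  pr P (A `&` [set w | Y e t w = b]) =
  \sum_(a : bool) pr P (A `&` [set w | Y e s w = a]) * edge_kernel (t - s) a b.
Proof.
move=> s0 st FA.
have := edge_markov (sigma e) rate_gt0 (HN e) (pr_outcome e)
  (@edge_updates_independent e) b s0 st FA.
have Ym c : measurable [set w | Y e s w = c].
  by apply: edge_sigma_measurable; exact: edge_state_sigma.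
have Am : measurable A by apply: edge_sigma_measurable; exact: past_edge_sigma FA.
move=> ->; rewrite big_bool /edge_kernel.
have -> : pr P A = pr P (A `&` [set w | Y e s w = true]) +
                   pr P (A `&` [set w | Y e s w = false]).
  rewrite -prU -?setIUr.
  - congr (pr P _); apply/seteqP; split => [w Aw|w []//]; split => //=.
    by case: (edge_state _ _ _ _ _); [left|right].
  - exact: measurableI.
  - exact: measurableI.
  - by rewrite -subset0 => w /= [[_ ->] []].
by case: b => /=; ring.
Qed.

Definition initial_state w : {ffun vpair n -> bool} := [ffun e => X0 e w].

Lemma initial_state_measurable x : measurable [set w | initial_state w = x].
Proof.
rewrite (_ : [set w | _] = \bigcap_e [set w | X0 e w = x e]).
  by apply: measurable_bigcap_fin => e; exact: measurable_level.
apply/seteqP; split => w /= => [<- e _|Xx]; first by rewrite ffunE.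
by apply/ffunP => e; rewrite ffunE Xx.
Qed.

Lemma initial_state_preimage_measurable (S : set {ffun vpair n -> bool}) :
  measurable [set w | S (initial_state w)].
Proof.
rewrite -[measurable](sigma_algebra_id (sigma_algebra_measurable Omega)).
apply: (@sigma_level_preimage _ _ _ initial_state S) => x.
by apply: sub_sigma_algebra; exact: initial_state_measurable.
Qed.

Lemma er_graph0 w : er_graph N U X0 0 w = initial_state w.
Proof. by apply/ffunP => e; rewrite !ffunE /er_edge (poisson_start (HN e)). Qed.

Lemma pr_initial_state : pr P [set w | initial_state w = sigma] = 1.
Proof.
rewrite (_ : [set w | _] = [set w | er_graph N U X0 0 w = sigma]).
  by rewrite /pr H0.
by apply/seteqP; split => w /=; rewrite er_graph0.
Qed.

Lemma pr_setI_initial_state Z : measurable Z ->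
  pr P (Z `&` [set w | initial_state w = sigma]) = pr P Z.
Proof.
move=> mZ; have mI := initial_state_measurable sigma.
apply/eqP; rewrite eq_le le_pr//; last exact: measurableI.
have mZI : measurable (Z `&` [set w | initial_state w = sigma]) by exact: measurableI.
have mIC := measurableC mI.
rewrite /= -[leRHS]addr0 -(subrr 1) -[X in _ - X]pr_initial_state -pr_setC//.
rewrite -prU//; last by rewrite -setIA setICr setI0.
apply: le_pr => //; first exact: measurableU.
by move=> w Zw; have [wI|wI] := pselect (initial_state w = sigma); [left|right].
Qed.

Lemma er_edge_initial_state e t w :
  initial_state w = sigma -> er_edge N U X0 e t w = Y e t w.
Proof. by move=> /(congr1 (fun f : {ffun _ -> _} => f e)); rewrite ffunE /er_edge => ->. Qed.

(** A pi-system that generates the filtration. The initial state is kept as a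
separate factor: it is constant almost surely, hence independent of everything
else, although it is not part of the independent family. *)
Definition past_rectangle s : set_system Omega := [set B |
  exists (S : set {ffun vpair n -> bool}) (A : vpair n -> set Omega),
    (forall e, past_edge e s (A e)) /\
    B = [set w | S (initial_state w)] `&` \bigcap_e A e].

(** Almost surely the initial state is [sigma], so the first factor is trivial and
the rest splits over the independent edges. *)
Lemma pr_past_rectangle s (S : set {ffun vpair n -> bool}) (A : vpair n -> set Omega) Z Z' :
  (forall e, past_edge e s (A e)) -> measurable Z -> (forall e, edge_sigma e (Z' e)) ->
  (forall w, initial_state w = sigma -> Z w <-> forall e, Z' e w) ->
  pr P ([set w | S (initial_state w)] `&` \bigcap_e A e `&` Z) =
  (`[< S sigma >])%:R * \prod_e pr P (A e `&` Z' e).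
Proof.
move=> FA mZ sZ' ZZ'.
have sA e : edge_sigma e (A e) by exact: past_edge_sigma (FA e).
have mS := initial_state_preimage_measurable S.
have mA : measurable (\bigcap_e A e).
  by apply: measurable_bigcap_fin => e; exact: edge_sigma_measurable.
rewrite -pr_setI_initial_state; last exact: measurableI (measurableI _ _ mS mA) mZ.
have mAZ e : edge_sigma e (A e `&` Z' e).
  by apply: sigma_setI; [exact: sA|exact: sZ'].
have [Ss|nSs] := boolP `[< S sigma >]; last first.
  rewrite mul0r (_ : _ `&` _ = set0) ?pr0// -subset0 => w /= [[[Sw _] _] ws].
  by move/asboolP: nSs; apply; rewrite -ws.
rewrite mul1r -(pr_bigcap_fin edges_independent mAZ) -[RHS]pr_setI_initial_state; last first.
  by apply: measurable_bigcap_fin => e; exact: edge_sigma_measurable (mAZ e).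
congr (pr P _); apply/seteqP; split => w /=.
  move=> [[[_ Aw] Zw] ws]; split => // e _.
  by split; [exact: Aw|move/(ZZ' w ws): Zw; exact].
move=> [AZw ws]; split => //; split; last by apply/(ZZ' w ws) => e; have [] := AZw e I.
by split => [|e _]; [rewrite ws; exact/asboolP|have [] := AZw e I].
Qed.

Lemma past_rectangle_setI s : setI_closed (past_rectangle s).
Proof.
move=> _ _ [S [A [FA ->]]] [S' [A' [FA' ->]]].
exists (S `&` S'), (fun e => A e `&` A' e); split => [e|].
  by apply: sigma_setI; [exact: FA|exact: FA'].
by rewrite setIACA bigcapI.
Qed.

Lemma past_rectangle_setT s : past_rectangle s setT.
Proof.
exists setT, (fun=> setT); split => [e|]; first exact: sigma_setT.
by apply/seteqP; split.
Qed.

Lemma past_rectangle_measurable s : past_rectangle s `<=` measurable.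
Proof.
move=> _ [S [A [FA ->]]]; apply: measurableI; last first.
  apply: measurable_bigcap_fin => e; apply: edge_sigma_measurable.
  exact: past_edge_sigma (FA e).
exact: initial_state_preimage_measurable.
Qed.

Lemma er_filtration_rectangle s :
  er_filtration N U X0 s `<=` <<s past_rectangle s >>.
Proof.
have one e B : past_edge e s B -> past_rectangle s B.
  move=> FB; exists setT, (fun e' => if e' == e then B else setT); split => [e'|].
    by case: eqVneq => [->//|_]; exact: sigma_setT.
  rewrite setTI; apply/seteqP; split => w /= => [Bw e' _|/(_ e I)].
    by case: eqVneq.
  by rewrite eqxx.
apply: sub_sigma => _ [[e [b ->]]|[e [r [k [r0 rs ->]]]]|[e [r [k [b [r0 rs ->]]]]]];
  apply: sub_sigma_algebra.
- exists [set x | x e = b], (fun=> setT); split => [e'|]; first exact: sigma_setT.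
  apply/seteqP; split => w /=; first by rewrite ffunE.
  by rewrite ffunE => -[].
- by apply: (one e); apply: sub_sigma_algebra; left; exists r, k.
- by apply: (one e); apply: sub_sigma_algebra; right; exists r, k, b.
Qed.

Lemma er_edge_filtration e s b : 0 <= s ->
  er_filtration N U X0 s [set w | er_edge N U X0 e s w = b].
Proof.
move=> s0; apply: sigma_updated_state => [k|k|]; apply: sub_sigma_algebra.
- by apply: Or32; exists e, s, k.
- by apply: Or33; exists e, s, k, b.
- by apply: Or31; exists e, b.
Qed.

Lemma er_filtration_measurable s : er_filtration N U X0 s `<=` measurable.
Proof.
by move=> A /er_filtration_rectangle; apply: sigma_measurable; exact: past_rectangle_measurable.
Qed.

Lemma adapted_er_edge e : adapted (er_filtration N U X0) (er_edge N U X0 e).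
Proof. by move=> t b; exact: er_edge_filtration. Qed.

Lemma adapted_er_graph : adapted (er_filtration N U X0) (er_graph N U X0).
Proof.
move=> t x t0.
rewrite (_ : [set w | _] = \bigcap_e [set w | er_edge N U X0 e t w = x e]).
  by rewrite bigcap_fin_fset; apply: sigma_fin_bigcap => e _; exact: er_edge_filtration.
apply/seteqP; split => w /= => [<- e _|Xx]; first by rewrite ffunE.
by apply/ffunP => e; rewrite ffunE Xx.
Qed.

Lemma er_edge_markov e s t b A : 0 <= s -> s <= t -> er_filtration N U X0 s A ->
  kernel_relation P [set w | er_edge N U X0 e t w = b]
    (fun a => [set w | er_edge N U X0 e s w = a])
    (fun a => edge_kernel (t - s) a b) A.
Proof.
move=> s0 st /er_filtration_rectangle; have t0 := le_trans s0 st.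
have Xm r c : 0 <= r -> measurable [set w | er_edge N U X0 e r w = c].
  by move=> r0; exact: er_filtration_measurable (adapted_er_edge _ _ _).
apply: kernel_relation_sigma => //.
- exact: Xm.
- by move=> a; exact: Xm.
- exact: past_rectangle_setI.
- exact: past_rectangle_setT.
- exact: past_rectangle_measurable.
move=> _ [S [A' [FA ->]]]; rewrite /kernel_relation.
have E r c : 0 <= r -> pr P ([set w | S (initial_state w)] `&` \bigcap_e A' e `&`
      [set w | er_edge N U X0 e r w = c]) =
    (`[< S sigma >])%:R * (\prod_(e' | e' != e) pr P (A' e')) *
      pr P (A' e `&` [set w | Y e r w = c]).
  move=> r0; rewrite (@pr_past_rectangle s _ _ _
    (fun e' => if e' == e then [set w | Y e r w = c] else setT))//; last first.
  - move=> w ws /=; rewrite er_edge_initial_state//; split => [Yw e'|/(_ e)].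
      by case: eqVneq.
    by rewrite eqxx.
  - move=> e'; case: eqVneq => [->|_]; last exact: sigma_setT.
    exact: edge_state_sigma.
  - exact: Xm.
  rewrite (bigD1 e)//= eqxx [X in _ * X]mulrC mulrA; congr (_ * _ * _).
  by apply: eq_bigr => e' /negbTE ->; rewrite setIT.
rewrite E// (edge_kernel_relation _ s0 st (FA e)) mulr_sumr; apply: eq_bigr => a _.
by rewrite E// mulrA.
Qed.

(** Expanding the product over the edges of the one-edge transition relations gives
a sum over the states of the graph. *)
Lemma er_graph_markov s t y A : 0 <= s -> s <= t -> er_filtration N U X0 s A ->
  kernel_relation P [set w | er_graph N U X0 t w = y]
    (fun x => [set w | er_graph N U X0 s w = x])
    (fun x => graph_kernel (t - s) x y) A.
Proof.
move=> s0 st /er_filtration_rectangle; have t0 := le_trans s0 st.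
have Xm r c : 0 <= r -> measurable [set w | er_graph N U X0 r w = c].
  by move=> r0; exact: er_filtration_measurable (adapted_er_graph _ _).
apply: kernel_relation_sigma => //.
- exact: Xm.
- by move=> a; exact: Xm.
- exact: past_rectangle_setI.
- exact: past_rectangle_setT.
- exact: past_rectangle_measurable.
move=> _ [S [A' [FA ->]]]; rewrite /kernel_relation.
have E r c : 0 <= r -> pr P ([set w | S (initial_state w)] `&` \bigcap_e A' e `&`
      [set w | er_graph N U X0 r w = c]) =
    (`[< S sigma >])%:R * \prod_e pr P (A' e `&` [set w | Y e r w = c e]).
  move=> r0; rewrite (@pr_past_rectangle s _ _ _
    (fun e => [set w | Y e r w = c e]))//.
  - exact: Xm.
  - by move=> e; exact: edge_state_sigma.
  - move=> w ws /=; split => [<- e|Yw]; first by rewrite ffunE er_edge_initial_state.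
    by apply/ffunP => e; rewrite ffunE er_edge_initial_state.
rewrite E//; under eq_bigr => e _ do rewrite (edge_kernel_relation _ s0 st (FA e)).
rewrite bigA_distr_bigA mulr_sumr /=; apply: eq_bigr => x _.
by rewrite E// -mulrA -big_split.
Qed.

(** * First update times *)

Lemma first_point_ge0 e w : (0 <= first_point (N e) w)%E.
Proof. by apply/ereal_infP => _ [t [t0 _] <-]; rewrite lee_fin. Qed.

(** By right continuity, a process that is still at [0] at time [t] stays there for a
while, so its first point is strictly later than [t]. *)
Lemma first_point_le e w (t : R) : 0 <= t ->
  (first_point (N e) w <= t%:E)%E <-> (0 < N e t w)%N.
Proof.
move=> t0; split => [|Nt]; last by apply: ereal_inf_lbound; exists t.
apply: contraPT; rewrite -leqNgt leqn0 => /eqP Nt; apply/negP; rewrite -ltNge.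
have := poisson_right_continuous (HN e) w t0.
rewrite /at_right near_withinE => /nbhs_ballP[/= eps eps0 Heps].
apply: (@lt_le_trans _ _ (t + eps)%:E); first by rewrite lte_fin ltrDl.
apply/ereal_infP => _ [s [s0 Ns] <-]; rewrite lee_fin leNgt; apply/negP => st.
have [ts|st'] := ltP t s.
  have sball : ball t eps s.
    by rewrite /ball /= distrC ger0_norm ?subr_ge0 ?ltW// ltrBlDl.
  by rewrite (Heps s sball ts) Nt in Ns.
by have := poisson_nondecreasing (HN e) w s0 st'; rewrite Nt leqNgt Ns.
Qed.

Definition last_first_point w := \big[maxe/-oo%E]_(e : vpair n) first_point (N e) w.

Lemma last_first_point_le w (t : R) : 0 <= t ->
  (last_first_point w <= t%:E)%E <-> (forall e, (0 < N e t w)%N).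
Proof.
move=> t0; split => [/bigmax_leP[_ Tt] e|Nt].
  by apply/first_point_le => //; exact: Tt.
by apply/bigmax_leP; split; [exact: leNye|move=> e _; apply/first_point_le].
Qed.

Lemma card_vpair : #|vpair n| = 'C(n, 2).
Proof. by rewrite card_sig -[X in 'C(X, _)](card_ord n) -card_draws cardsE. Qed.

Lemma vpair_inhabited : exists e : vpair n, true.
Proof.
have : (0 < #|vpair n|)%N by rewrite card_vpair bin_gt0.
by move=> /card_gt0P[e _]; exists e.
Qed.

Lemma last_first_point_ge0 w : (0 <= last_first_point w)%E.
Proof.
have [e _] := vpair_inhabited.
exact: le_trans (first_point_ge0 e w) (le_bigmax _ _ e).
Qed.

Lemma pr_first_point_le e t : 0 <= t ->
  pr P [set w | (0 < N e t w)%N] = 1 - no_update_prob rate t.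
Proof.
move=> t0.
have -> : [set w | (0 < N e t w)%N] = ~` [set w | (N e t w - N e 0 w)%N = 0%N].
  apply/seteqP; split => w /=; rewrite (poisson_start (HN e)) subn0 lt0n.
    by move/eqP.
  by move=> ?; apply/eqP.
rewrite pr_setC; last first.
  under eq_set do rewrite (poisson_start (HN e)) subn0.
  exact: measurable_level.
by rewrite (pr_no_increment (HN e) rate_gt0)// subr0.
Qed.

Lemma update_seen_sigma e t : 0 <= t -> edge_sigma e [set w | (0 < N e t w)%N].
Proof.
move=> t0; apply: (@sigma_level_preimage _ _ _ (N e t) [set m | (0 < m)%N]) => m.
exact: edge_sigma_N.
Qed.

Lemma pr_last_first_point_le t : 0 <= t ->
  pr P [set w | (last_first_point w <= t%:E)%E] = (1 - no_update_prob rate t) ^+ 'C(n, 2).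
Proof.
move=> t0; rewrite (_ : [set w | _] = \bigcap_e [set w | (0 < N e t w)%N]); last first.
  by apply/seteqP; split => w /= => [/last_first_point_le Nt e _|Nt];
    [exact: Nt|apply/last_first_point_le => // e; exact: Nt].
rewrite (pr_bigcap_fin edges_independent); last by move=> e; exact: update_seen_sigma.
under eq_bigr do rewrite pr_first_point_le//.
by rewrite prodr_const card_vpair.
Qed.

Definition update_times : set_system Omega := <<s \bigcup_e sigma_process (N e) >>.

Lemma update_times_N e r k : 0 <= r -> update_times [set w | N e r w = k].
Proof.
move=> r0; apply: sub_sigma_algebra; exists e => //; apply: sub_sigma_algebra.
by exists r => //; exact: preimage_nat_level.
Qed.

Lemma update_times_measurable : update_times `<=` measurable.
Proof. by apply: sigma_measurable => A [e _]; exact: sigma_process_measurable. Qed.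

Lemma update_times_outcomes_independent B (k : vpair n -> nat) (C : vpair n -> set Omega) :
  update_times B -> (forall e, g_sigma_algebra_preimage (U e (k e)) (C e)) ->
  pr P (B `&` \bigcap_e C e) = pr P B * \prod_e pr P (C e).
Proof.
move=> uB UC.
pose is_time (i : vpair n + vpair n * nat) : bool := if i is inl _ then true else false.
have EI : forall i : vpair n + vpair n * nat, setI_closed (match i with
      | inl e => sigma_process (N e)
      | inr (e, k) => g_sigma_algebra_preimage (U e k) end).
  by case=> [e|[e j]]; [exact: sigma_setI|exact: gsa_preimage_setI].
have ET : forall i : vpair n + vpair n * nat, (match i with
      | inl e => sigma_process (N e)
      | inr (e, k) => g_sigma_algebra_preimage (U e k) end) setT.
  by case=> [e|[e j]]; [exact: sigma_setT|exact: gsa_preimage_setT].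
have Em : forall i : vpair n + vpair n * nat, (match i with
      | inl e => sigma_process (N e)
      | inr (e, k) => g_sigma_algebra_preimage (U e k) end) `<=` measurable.
  by case=> [e|[e j]]; [exact: sigma_process_measurable|exact: gsa_preimage_measurable].
have hI : injective (fun e => inr (e, k e) : vpair n + vpair n * nat) by move=> e e' [].
rewrite -(pr_bigcap_fin (mutually_independent_inj hI (updates_independent HD)) UC).
have := mutually_independent_group (g := is_time) EI ET Em (updates_independent HD).
move=> /(_ [fset true; false]%fset (fun b => if b then B else \bigcap_e C e)).
rewrite bigcap_fset !big_fsetU1 ?inE//= !big_seq_fset1; apply; case=> _.
  move: B uB; apply: sub_sigma => B [e _ NB].
  by apply: sub_sigma_algebra; exists (inl e).
rewrite bigcap_fin_fset; apply: sigma_fin_bigcap => e _.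
by apply: sub_sigma_algebra; exists (inr (e, k e)).
Qed.

Lemma er_edge_right_continuous e w r : 0 <= r ->
  \forall s \near r^'+, er_edge N U X0 e s w = er_edge N U X0 e r w.
Proof.
move=> r0; apply: filterS (poisson_right_continuous (HN e) w r0) => s Ns.
by rewrite /er_edge Ns.
Qed.

Lemma er_graph_right_continuous w r : 0 <= r ->
  \forall s \near r^'+, er_graph N U X0 s w = er_graph N U X0 r w.
Proof.
move=> r0.
have Xr : \forall s \near r^'+, forall e, er_edge N U X0 e s w = er_edge N U X0 e r w.
  by apply: filter_forall => e; exact: er_edge_right_continuous.
by apply: filterS Xr => s Xs; apply/ffunP => e; rewrite !ffunE.
Qed.

Definition update_counts r w : {ffun vpair n -> nat} := [ffun e => N e r w].

Lemma update_counts_sigma r k : 0 <= r -> update_times [set w | update_counts r w = k].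
Proof.
move=> r0.
rewrite (_ : [set w | _] = \bigcap_e [set w | N e r w = k e]).
  by rewrite bigcap_fin_fset; apply: sigma_fin_bigcap => e _; exact: update_times_N.
apply/seteqP; split => w /= => [<- e _|Xx]; first by rewrite ffunE.
by apply/ffunP => e; rewrite ffunE Xx.
Qed.

Lemma update_counts_right_continuous w r : 0 <= r ->
  \forall s \near r^'+, update_counts s w = update_counts r w.
Proof.
move=> r0.
have Nr : \forall s \near r^'+, forall e, N e s w = N e r w.
  by apply: filter_forall => e; exact: (poisson_right_continuous (HN e)).
by apply: filterS Nr => s Ns; apply/ffunP => e; rewrite !ffunE.
Qed.

(** If [T] depends on the update times only and each edge of [D] has been updated by
time [T], then these edges show at time [T] outcomes whose indices are determined
by the update times. The outcomes are independent of the update times, so the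
edges have the product law independently of [T]. *)
Lemma stationary_after_updates (D : {set vpair n}) (T : Omega -> \bar R) (t : R)
    (y : vpair n -> bool) :
  0 <= t -> (forall w, (0 <= T w)%E) ->
  (forall r : R, 0 <= r -> update_times [set w | (T w <= r%:E)%E]) ->
  (forall w e, e \in D -> (T w < +oo)%E -> (0 < N e (fine (T w)) w)%N) ->
  pr P [set w | (T w <= t%:E)%E /\ forall e, e \in D -> er_edge N U X0 e (fine (T w)) w = y e] =
  pr P [set w | (T w <= t%:E)%E] * \prod_(e in D) bernoulli_pmf p (y e).
Proof.
move=> t0 T0 uT updated.
set A := [set w | (T w <= t%:E)%E].
set W := [set w | _ /\ _].
have mA : measurable A by apply: update_times_measurable; exact: uT.
have mW : measurable W.
  rewrite (_ : W = A `&` \bigcap_e (if e \in D then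
      [set w | (T w <= t%:E)%E /\ er_edge N U X0 e (fine (T w)) w = y e] else setT)).
    apply: measurableI => //; apply: measurable_bigcap_fin => e; case: ifP => // _.
    rewrite -[measurable](sigma_algebra_id (sigma_algebra_measurable Omega)).
    apply: (stopped_state_sigma T0 _ _ (er_edge_right_continuous e)) => // r.
      by move=> r0; apply: sub_sigma_algebra; apply: update_times_measurable; exact: uT.
    move=> x r0; apply: sub_sigma_algebra.
    by apply: er_filtration_measurable; exact: adapted_er_edge r0.
  apply/seteqP; split => w; first by move=> [Tw Xw]; split => // e _; case: ifP => // /Xw.
  by move=> [Tw Xw]; split => // e eD; have := Xw e I; rewrite eD => -[].
pose B (b : bool) := if b then W else setT.
pose c (b : bool) := if b then 1 else - \prod_(e in D) bernoulli_pmf p (y e).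
have mB : forall b, measurable (B b) by case; [exact: mW|exact: measurableT].
have kappaA k : update_times (A `&` [set w | update_counts (fine (T w)) w = k]).
  exact: (stopped_state_sigma T0 uT update_counts_sigma update_counts_right_continuous).
suff : null_relation P B c A.
  rewrite /null_relation big_bool /B /c /= setIT mul1r mulNr => /subr0_eq.
  by rewrite (_ : A `&` W = W) 1?mulrC//; apply/setIidPr => w [].
apply: (null_relation_partition mB (kappa := fun w => update_counts (fine (T w)) w)) => k.
  exact: update_times_measurable (kappaA k).
rewrite /null_relation big_bool /B /c /= setIT mul1r mulNr.
have [kD|] := boolP [forall e in D, 0 < k e]%N; last first.
  rewrite negb_forall_in => /exists_inP[e eD]; rewrite -leqNgt leqn0 => /eqP ke.
  rewrite (_ : A `&` [set w | update_counts (fine (T w)) w = k] = set0).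
    by rewrite set0I pr0 mulr0 subrr.
  rewrite -subset0 => w [Tw /= kw].
  have := updated w e eD (le_lt_trans Tw (ltry t)).
  by rewrite -[N e _ w](ffunE (fun e => N e (fine (T w)) w)) -/(update_counts _ _) kw ke.
pose C e := if e \in D then [set w | U e (k e).-1 w = y e] else setT.
have -> : A `&` [set w | update_counts (fine (T w)) w = k] `&` W =
    (A `&` [set w | update_counts (fine (T w)) w = k]) `&` \bigcap_e C e.
  apply/seteqP; split => w [[Tw /= kw]].
    move=> [_ Xw]; split => // e _; rewrite /C; case: ifP => // eD.
    have := Xw e eD; rewrite /er_edge.
    have := forall_inP kD e eD.
    by rewrite -kw ffunE /=; case: (N e _ w).
  move=> Cw; split => //; split => // e eD; have := Cw e I; rewrite /C eD /er_edge.
  have := forall_inP kD e eD.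
  by rewrite -kw ffunE /=; case: (N e _ w).
rewrite (update_times_outcomes_independent (k := fun e => (k e).-1) (kappaA k)); last first.
  move=> e; rewrite /C; case: ifP => _; last exact: gsa_preimage_setT.
  exact: (@level_g_sigma_algebra_preimage _ _ _ (U e (k e).-1) [set y e]).
rewrite [X in _ - X * _](_ : _ = \prod_e pr P (C e)); first by rewrite mulrC subrr.
rewrite big_mkcond /=; apply: eq_bigr => e _; rewrite /C; case: ifP => _.
  by rewrite pr_outcome.
by rewrite prT.
Qed.

(** * Optimality *)

Local Notation F := (er_filtration N U X0).
Local Notation Xe := (er_edge N U X0).
Local Notation Xg := (er_graph N U X0).

Lemma F_update_seen e t : 0 <= t -> F t [set w | (0 < N e t w)%N].
Proof.
move=> t0; apply: (@sigma_level_preimage _ _ _ (N e t) [set m | (0 < m)%N]) => m.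
by apply: sub_sigma_algebra; apply: Or32; exists e, t, m.
Qed.

Lemma first_point_leE e t : 0 <= t ->
  [set w | (first_point (N e) w <= t%:E)%E] = [set w | (0 < N e t w)%N].
Proof. by move=> t0; apply/seteqP; split => w /= /first_point_le; apply. Qed.

Lemma last_first_point_leE t : 0 <= t ->
  [set w | (last_first_point w <= t%:E)%E] = \bigcap_e [set w | (0 < N e t w)%N].
Proof.
move=> t0; apply/seteqP; split => w /=.
  by move=> /(last_first_point_le w t0) Nt e _; exact: Nt.
by move=> Nt; apply/last_first_point_le => // e; exact: Nt.
Qed.

Lemma update_times_update_seen e t : 0 <= t -> update_times [set w | (0 < N e t w)%N].
Proof.
move=> t0; apply: (@sigma_level_preimage _ _ _ (N e t) [set m | (0 < m)%N]) => m.
exact: update_times_N.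
Qed.

Lemma first_point_strong_stationary e :
  strong_stationary_time P F (Xe e) (bernoulli_pmf p) (first_point (N e)).
Proof.
apply: strong_stationary_timeI; first exact: adapted_er_edge.
  apply: stopping_time_randomized => [|w|t t0].
  - exact: er_filtration_measurable.
  - exact: first_point_ge0.
  - by rewrite first_point_leE//; exact: F_update_seen.
move=> t b t0.
have := @stationary_after_updates [set e]%SET (first_point (N e)) t (fun=> b) t0
  (first_point_ge0 e).
rewrite big_set1 => <-.
- congr (pr P _); apply/seteqP; split => w /= [Tw Xw]; split => //.
    by move=> e'; rewrite inE => /eqP ->.
  by apply: Xw; rewrite inE.
- by move=> r r0; rewrite first_point_leE//; exact: update_times_update_seen.
- move=> w e'; rewrite inE => /eqP -> Tw.
  have Tf : first_point (N e) w \is a fin_num by rewrite ge0_fin_numE// first_point_ge0.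
  by apply/first_point_le; rewrite ?fine_ge0 ?first_point_ge0// fineK.
Qed.

Lemma last_first_point_strong_stationary :
  strong_stationary_time P F Xg (static_er_pmf p (n := n)) last_first_point.
Proof.
apply: strong_stationary_timeI; first exact: adapted_er_graph.
  apply: stopping_time_randomized => [|w|t t0].
  - exact: er_filtration_measurable.
  - exact: last_first_point_ge0.
  - rewrite last_first_point_leE// bigcap_fin_fset.
    by apply: sigma_fin_bigcap => e _; exact: F_update_seen.
move=> t y t0.
have := @stationary_after_updates [set: vpair n]%SET last_first_point t y t0
  last_first_point_ge0.
rewrite (eq_bigl xpredT); last by move=> e; rewrite inE.
rewrite -/(static_er_pmf p y) => <-.
- congr (pr P _); apply/seteqP; split => w /= [Tw Xw]; split => //.
    by move=> e _; rewrite -Xw ffunE.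
  by apply/ffunP => e; rewrite ffunE Xw// inE.
- move=> r r0; rewrite last_first_point_leE// bigcap_fin_fset.
  by apply: sigma_fin_bigcap => e _; exact: update_times_update_seen.
- move=> w e _ Tw.
  have Tf : last_first_point w \is a fin_num by rewrite ge0_fin_numE// last_first_point_ge0.
  have f0 : 0 <= fine (last_first_point w) by rewrite fine_ge0// last_first_point_ge0.
  by have /(last_first_point_le w f0) : (last_first_point w <= (fine (last_first_point w))%:E)%E
    by rewrite fineK.
Qed.

Lemma no_update_prob_bounds u : 0 <= u -> 0 <= no_update_prob rate u <= 1.
Proof. by move=> u0; rewrite expR_ge0 expR_le1 mulNr oppr_le0 mulr_ge0// ltW// rate_gt0. Qed.

Lemma edge_kernel_bounds u a b : 0 <= u -> 0 <= edge_kernel u a b <= 1.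
Proof.
move=> /no_update_prob_bounds/andP[k0 k1].
have q0 : 0 <= 1 - no_update_prob rate u by rewrite subr_ge0.
have pb0 := bernoulli_edge_prob_gt0 b.
have pb1 : bernoulli_pmf p b <= 1.
  by case: (b) => /=; [rewrite ltW// edge_prob_lt1|rewrite gerBl ltW// edge_prob_gt0].
have ab0 : 0 <= (a == b)%:R :> R by rewrite ler0n.
have ab1 : (a == b)%:R <= 1 :> R by case: (a == b).
rewrite /edge_kernel; apply/andP; split.
  exact: addr_ge0 (mulr_ge0 k0 ab0) (mulr_ge0 q0 (ltW pb0)).
by have := lerD (ler_piMr k0 ab1) (ler_piMr q0 pb1); rewrite [leRHS]addrC subrK.
Qed.

Lemma edge_kernel_stationary u b :
  \sum_(a : bool) bernoulli_pmf p a * edge_kernel u a b = bernoulli_pmf p b.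
Proof. by rewrite big_bool /edge_kernel; case: b => /=; ring. Qed.

Lemma graph_kernel_stationary u y :
  \sum_x static_er_pmf p x * graph_kernel u x y = static_er_pmf p y.
Proof.
rewrite /static_er_pmf; under [RHS]eq_bigr do rewrite -(edge_kernel_stationary u).
rewrite bigA_distr_bigA /=; apply: eq_bigr => x _.
by rewrite /graph_kernel -big_split.
Qed.

Lemma graph_kernel_bounds u x y : 0 <= u -> 0 <= graph_kernel u x y <= 1.
Proof.
move=> u0; apply/andP; split.
  by apply: prodr_ge0 => e _; have /andP[] := edge_kernel_bounds (x e) (y e) u0.
by apply: prodr_ile1 => e _; exact: edge_kernel_bounds.
Qed.

Lemma er_filtration_mono s t : s <= t -> F s `<=` F t.
Proof.
move=> st; apply: sub_sigma => A; case=> [XA|[e [r [k [r0 rs ->]]]]|[e [r [k [b [r0 rs ->]]]]]];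
  apply: sub_sigma_algebra.
- exact: Or31.
- by apply: Or32; exists e, r, k; rewrite (le_trans rs).
- by apply: Or33; exists e, r, k, b; rewrite (le_trans rs).
Qed.

(** An event decided by the initial state has probability [0] or [1]. *)
Lemma pr_initial_state_event Z (c : bool) : measurable Z ->
  (forall w, initial_state w = sigma -> Z w <-> c) -> pr P Z = c%:R.
Proof.
move=> mZ Zc; rewrite -(pr_setI_initial_state mZ); case: c Zc => Zc.
  rewrite -pr_initial_state; congr (pr P _); apply/seteqP; split => w [] // ws; split => //.
  exact/Zc.
rewrite (_ : _ `&` _ = set0) ?pr0// -subset0 => w [Zw ws].
by have /(Zc w ws) := Zw.
Qed.

(** The flipped initial state can only be reached through an update, which makes
the bound of [strong_stationary_time_bound] an equality for the first point. *)
Lemma pr_er_edge_flipped e t : 0 <= t ->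
  pr P [set w | Xe e t w = ~~ sigma e] =
  (1 - no_update_prob rate t) * bernoulli_pmf p (~~ sigma e).
Proof.
move=> t0; have FT : F 0 setT by exact: sigma_setT.
have := er_edge_markov e (~~ sigma e) (lexx 0) t0 FT.
rewrite /kernel_relation setTI subr0 => ->.
have init0 a : pr P (setT `&` [set w | Xe e 0 w = a]) = (sigma e == a)%:R.
  rewrite setTI; apply: pr_initial_state_event.
    by apply: er_filtration_measurable; exact: adapted_er_edge (lexx 0).
  move=> w ws /=; rewrite er_edge_initial_state// /edge_state (poisson_start (HN e)).
  by split => [->|/eqP].
rewrite big_bool !init0 /edge_kernel; case: (sigma e) => /=; ring.
Qed.

(** To differ from the initial state at every edge, each edge must have been
updated. *)
Lemma pr_er_graph_flipped t : 0 <= t ->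
  pr P [set w | Xg t w = [ffun e => ~~ sigma e]] =
  (1 - no_update_prob rate t) ^+ 'C(n, 2) * static_er_pmf p [ffun e => ~~ sigma e].
Proof.
move=> t0; have FT : F 0 setT by exact: sigma_setT.
have := er_graph_markov [ffun e => ~~ sigma e] (lexx 0) t0 FT.
rewrite /kernel_relation setTI subr0 => ->.
have init0 x : pr P (setT `&` [set w | Xg 0 w = x]) = (sigma == x)%:R.
  rewrite setTI; apply: pr_initial_state_event.
    by apply: er_filtration_measurable; exact: adapted_er_graph (lexx 0).
  by move=> w ws /=; rewrite er_graph0 ws; split => [->|/eqP].
rewrite (bigD1 sigma)//= init0 eqxx mul1r big1 ?addr0; last first.
  by move=> x xs; rewrite init0 eq_sym (negbTE xs) mul0r.
rewrite -card_vpair -prodr_const /static_er_pmf -big_split; apply: eq_bigr => e _.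
by rewrite /edge_kernel ffunE; case: (sigma e) => /=; rewrite mulr0 add0r.
Qed.

Lemma er_filtration_bound (S : finType) (X : R -> Omega -> S) (pi : S -> R)
    (T : Omega -> \bar R) (y : S) (h : R -> S -> R) t :
  (forall w r, 0 <= r -> \forall s \near r^'+, X s w = X r w) ->
  (forall s t A, 0 <= s -> s <= t -> F s A ->
    kernel_relation P [set w | X t w = y] (fun x => [set w | X s w = x]) (h (t - s)) A) ->
  (forall u x, 0 <= u -> 0 <= h u x <= 1) ->
  (forall u, 0 <= u -> \sum_(x : S) pi x * h u x = pi y) ->
  strong_stationary_time P F X pi T -> 0 <= t ->
  pr P [set w | (T w <= t%:E)%E] * pi y <= pr P [set w | X t w = y].
Proof.
move=> rcX markovX h01 stat sstT t0.
apply: (strong_stationary_time_bound (F := F) (h := h)) => //.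
- by move=> s; exact: er_filtration_measurable.
- by move=> s; exact: sigma_setI.
- by move=> s; exact: sigma_setT.
- exact: er_filtration_mono.
Qed.

Lemma first_point_fastest e :
  fastest_time_to_stationarity P F (Xe e) (bernoulli_pmf p) (first_point (N e)).
Proof.
apply: (@fastest_of_attained_bound _ _ _ _ _ _ _ _ _ (~~ sigma e)).
- exact: first_point_strong_stationary.
- exact: bernoulli_edge_prob_gt0.
- move=> T t; apply: (er_filtration_bound (h := fun u a => edge_kernel u a (~~ sigma e))).
  + by move=> w r; exact: er_edge_right_continuous.
  + by move=> r s A; exact: er_edge_markov.
  + by move=> u a; exact: edge_kernel_bounds.
  + by move=> u _; exact: edge_kernel_stationary.
- by move=> t t0; rewrite pr_er_edge_flipped// first_point_leE// pr_first_point_le.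
Qed.

Lemma last_first_point_fastest :
  fastest_time_to_stationarity P F Xg (static_er_pmf p (n := n)) last_first_point.
Proof.
apply: (@fastest_of_attained_bound _ _ _ _ _ _ _ _ _ [ffun e => ~~ sigma e]).
- exact: last_first_point_strong_stationary.
- by apply: prodr_gt0 => e _; exact: bernoulli_edge_prob_gt0.
- move=> T t; apply: (er_filtration_bound
    (h := fun u x => graph_kernel u x [ffun e => ~~ sigma e])).
  + by move=> w r; exact: er_graph_right_continuous.
  + by move=> r s A; exact: er_graph_markov.
  + by move=> u x; exact: graph_kernel_bounds.
  + by move=> u _; exact: graph_kernel_stationary.
- by move=> t t0; rewrite pr_er_graph_flipped// pr_last_first_point_le.
Qed.

Lemma last_first_point_law t : 0 <= t ->
  P [set w | (last_first_point w <= t%:E)%E] = ((1 - no_update_prob rate t) ^+ 'C(n, 2))%:E.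
Proof.
move=> t0; rewrite -pr_last_first_point_le// -prE// last_first_point_leE//.
apply: measurable_bigcap_fin => e; apply: edge_sigma_measurable.
exact: update_seen_sigma.
Qed.

End dynamic_er.

Theorem theorem1 (R : realType) (alpha beta : R) (n : nat)
    (d : measure_display) (Omega : measurableType d) (P : probability Omega R)
    (N : vpair n -> R -> {RV P >-> nat})
    (U : vpair n -> nat -> {RV P >-> bool})
    (X0 : vpair n -> {RV P >-> bool})
    (sigma : {ffun vpair n -> bool}) :
  0 < alpha -> 0 < beta -> (2 <= n)%N ->
  dynamic_er_updates alpha beta N U ->
  P [set w | er_graph N U X0 0 w = sigma] = 1%E ->
  let p := edge_prob alpha beta n in
  let F := er_filtration N U X0 in
  let Ts := fun w : Omega => \big[maxe/-oo%E]_(e : vpair n) first_point (N e) w in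
  [/\ forall e : vpair n,
        fastest_time_to_stationarity P F (er_edge N U X0 e) (bernoulli_pmf p)
          (first_point (N e)),
      fastest_time_to_stationarity P F (er_graph N U X0) (static_er_pmf p (n := n)) Ts
    & forall t : R, 0 <= t ->
        P [set w | (Ts w <= t%:E)%E] =
          ((1 - expR (- (alpha + beta / (n%:R - 1)) * t)) ^+ 'C(n, 2))%:E].
Proof.
move=> a0 b0 n2 HD H0 p F Ts; split.
- by move=> e; exact: (first_point_fastest a0 b0 n2 HD H0).
- exact: (last_first_point_fastest a0 b0 n2 HD H0).
- by move=> t; exact: (last_first_point_law a0 b0 n2 HD).
Qed.
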